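(* Let $k$ be a field of characteristic $0$, $V$ a finite-dimensional $k$-vector space, $L(V)$ the free Lie algebra over $V$, and let $s\in V^{\otimes 2}$. Let $\delta_s: L(V)\to\bigwedge^2 L(V)$ be the $1$-cocycle given on generators $x\in V$ by $$\delta_s(x)=[s,x\otimes 1]-[s^{21},1\otimes x],$$ and let $\varphi_s=-\operatorname{cp}[s^{12},s^{13}]$. Then $(L(V),\delta_s,\varphi_s)$ is a quasi-Lie bialgebra. Moreover, $\delta_s$ satisfies the co-Jacobi identity, i.e. $\operatorname{cp}(\delta_s\otimes\mathrm{id})\delta_s=0$ on $L(V)$, if and only if $s=v\otimes w$ for some $v,w\in V$.
   Context: Notation: $T(V)$ is the tensor algebra, $U(L(V))=T(V)$ and $L(V)\subset T(V)$. All commutators are taken in the associative algebras $T(V)^{\otimes n}$. $s^{21}$ is the flip of $s$; for $s=\sum_i a_i\otimes b_i$, $s^{ij}\in T(V)^{\otimes n}$ has $a_i$'s in the $i$-th factor, $b_i$'s in the $j$-th factor and $1$ elsewhere (e.g. $s^{13}=\sum_i a_i\otimes 1\otimes b_i$). $\operatorname{cp}$ denotes the sum over the three cyclic permutations of the three tensor factors, so $\operatorname{cp}[s^{12},s^{13}]=[s^{12},s^{13}]+[s^{23},s^{21}]+[s^{31},s^{32}]$. $\operatorname{Alt}$ denotes the alternating sum over all permutations of the tensor factors (no normalization). $\bigwedge^n$ is regarded as the space of antisymmetric tensors. A $1$-cocycle $\delta:\mathfrak g\to\bigwedge^2\mathfrak g$ on a Lie algebra $\mathfrak g$ is a linear map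 with $\delta([x,y])=[x\otimes1+1\otimes x,\delta(y)]-[y\otimes 1+1\otimes y,\delta(x)]$. Since $L(V)$ is free, a $1$-cocycle on $L(V)$ is determined by its (arbitrary) values on $V$. A quasi-Lie bialgebra $(\mathfrak g,\delta,\varphi)$ is a Lie algebra $\mathfrak g$ with a $1$-cocycle $\delta:\mathfrak g\to\bigwedge^2\mathfrak g$ and an element $\varphi\in\bigwedge^3\mathfrak g$ such that for all $x\in\mathfrak g$ $$\operatorname{cp}(\delta\otimes\mathrm{id})\delta(x)=[x\otimes1\otimes1+1\otimes x\otimes1+1\otimes1\otimes x,\varphi],$$ and $\operatorname{Alt}(\delta\otimes\mathrm{id}\otimes\mathrm{id})(\varphi)=0$. *)

(* Defs.v *)
(* The tensor algebra T(V) is modelled on a basis x_0, ..., x_(n-1) of V: T(V) *)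
(* is the free associative algebra on the letters 'I_n, and its m-th tensor    *)
(* power is the monoid algebra of m-tuples of words, the tuple (w_0, ...,      *)
(* w_(m-1)) standing for the pure tensor w_0 (x) ... (x) w_(m-1). Tensor       *)
(* factors are numbered from 0, so s^{12} is [leg2 0 1 s].                     *)
From HB Require Import structures.
From mathcomp Require Import all_boot all_order all_fingroup all_algebra.
From mathcomp Require Import finmap.
From mathcomp.multinomials Require Import monalg.
Set Implicit Arguments.
Unset Strict Implicit.
Unset Printing Implicit Defensive.
Import GRing.Theory.

Local Open Scope ring_scope.

Definition mword (n m : nat) := {ffun 'I_m -> seq 'I_n}.

HB.instance Definition _ n m := Choice.on (mword n m).

Section MultiWord.
Variables n m : nat.
Implicit Types u v w : mword n m.

Definition mword_one : mword n m := [ffun=> [::]].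
Definition mword_mul u v : mword n m := [ffun i => u i ++ v i].

Lemma mword_mulA : associative mword_mul.
Proof. by move=> u v w; apply/ffunP=> i; rewrite !ffunE catA. Qed.

Lemma mword_mul1m : left_id mword_one mword_mul.
Proof. by move=> u; apply/ffunP=> i; rewrite !ffunE. Qed.

Lemma mword_mulm1 : right_id mword_one mword_mul.
Proof. by move=> u; apply/ffunP=> i; rewrite !ffunE cats0. Qed.

Lemma mword_unitm u v :
  mword_mul u v = mword_one -> u = mword_one /\ v = mword_one.
Proof.
move=> uv1; have uv i : u i = [::] /\ v i = [::].
  by have := congr1 (fun w : mword n m => w i) uv1;
    rewrite !ffunE; case: (u i) (v i) => [|? ?] [].
by split; apply/ffunP=> i; rewrite ffunE; have [] := uv i.
Qed.

HB.instance Definition _ := Choice_isMonomialDef.Build (mword n m)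
  mword_mulA mword_mul1m mword_mulm1 mword_unitm.

End MultiWord.

(* T(V)^{(x) m}; T(V) itself is [tens V 1]. *)
Definition tens (k : fieldType) (V : vectType k) (m : nat) :=
  {malg k[mword (\dim {:V}) m]}.

HB.instance Definition _ k V m := GRing.Lalgebra.on (@tens k V m).

Section Tensors.
Variables (k : fieldType) (V : vectType k).
Local Notation n := (\dim {:V}).
Local Notation T := (tens V 1).

Definition lin_ext m m' (f : mword n m -> tens V m') (t : tens V m) :
    tens V m' :=
  \sum_(w <- msupp t) t@_w *: f w.

Definition mono m (w : mword n m) : tens V m := << w >>.

Definition incl (v : V) : T :=
  \sum_(i < n) coord (vbasis {:V}) i v *: mono [ffun=> [:: i]].

(* For injective f: puts the i-th factor in position f i, and 1 in the         *)
(* positions outside the image of f.                                           *)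
Definition place m m' (f : 'I_m -> 'I_m') : tens V m -> tens V m' :=
  lin_ext (fun w => mono [ffun j =>
    if [pick i | f i == j] is Some i then w i else [::]]).

Definition leg m (i : 'I_m) (x : T) : tens V m := place (fun=> i) x.

Definition leg2 m (i j : 'I_m) (s : tens V 2) : tens V m :=
  place (fun a : 'I_2 => if a == 0 then i else j) s.

Definition pure m (a : 'I_m -> T) : tens V m := \prod_(i < m) leg i (a i).

Definition brk m (x y : tens V m) : tens V m := x * y - y * x.

(* x (x) 1 (x) ... (x) 1 + ... + 1 (x) ... (x) 1 (x) x *)
Definition diag m (x : T) : tens V m := \sum_(i < m) leg i x.

(* The image in T(V)^{(x) m} of the m-th tensor power of a subspace P. *)
Definition tensor_power (P : T -> Prop) m (t : tens V m) : Prop :=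
  exists (N : nat) (a : 'I_N -> 'I_m -> T),
    (forall j i, P (a j i)) /\ t = \sum_(j < N) pure (a j).

Definition antisymmetric m (t : tens V m) : Prop :=
  forall p : 'S_m, place p t = (-1) ^+ p *: t.

Definition exterior_power (P : T -> Prop) m (t : tens V m) : Prop :=
  tensor_power P t /\ antisymmetric t.

(* The cyclic permutations of 'I_3 = Z/3 are the translations. *)
Definition cp (t : tens V 3) : tens V 3 :=
  \sum_(c : 'I_3) place (fun i => i + c) t.

Definition Alt m (t : tens V m) : tens V m :=
  \sum_(p : 'S_m) (-1) ^+ p *: place p t.

(* d (x) id (x) ... (x) id, with p identity factors *)
Definition tens_id p (d : T -> tens V 2) : tens V p.+1 -> tens V p.+2 :=
  lin_ext (fun w =>
    place (@lshift 2 p) (d (mono [ffun=> w ord0])) *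
    place (@rshift 2 p) (mono [ffun i => w (lift ord0 i)])).

Definition lie_subalgebra (g : T -> Prop) : Prop :=
  [/\ g 0, forall x y, g x -> g y -> g (x + y),
      forall c x, g x -> g (c *: x) & forall x y, g x -> g y -> g (brk x y)].

(* L(V), realised in T(V) as the Lie subalgebra generated by V *)
Definition free_lie (x : T) : Prop :=
  forall g, lie_subalgebra g -> (forall v, g (incl v)) -> g x.

(* A linear map on the subspace g is represented by a linear map on T(V), of   *)
(* which only the restriction to g matters: every linear map on g extends, and *)
(* d (x) id on g (x) g only depends on the restriction.                        *)
Definition cocycle (g : T -> Prop) (d : {linear T -> tens V 2}) : Prop :=
  (forall x, g x -> exterior_power g (d x)) /\
  (forall x y, g x -> g y ->
     d (brk x y) = brk (diag 2 x) (d y) - brk (diag 2 y) (d x)).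

Definition co_jacobi (g : T -> Prop) (d : {linear T -> tens V 2}) : Prop :=
  forall x, g x -> cp (tens_id (p := 1) d (d x)) = 0.

Record quasi_lie_bialgebra (g : T -> Prop) (d : {linear T -> tens V 2})
    (phi : tens V 3) : Prop := QuasiLieBialgebra {
  qlb_lie : lie_subalgebra g;
  qlb_cocycle : cocycle g d;
  qlb_phi : exterior_power g phi;
  qlb_defect : forall x, g x ->
    cp (tens_id (p := 1) d (d x)) = brk (diag 3 x) phi;
  qlb_alt : Alt (tens_id (p := 2) d phi) = 0
}.

Definition in_V (x : T) : Prop := exists v, x = incl v.

Definition flip (s : tens V 2) : tens V 2 := leg2 1 0 s.

Definition is_delta (s : tens V 2) (d : {linear T -> tens V 2}) : Prop :=
  cocycle free_lie d /\
  forall v, d (incl v) =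
    brk s (leg 0 (incl v)) - brk (flip s) (leg 1 (incl v)).

Definition phi_s (s : tens V 2) : tens V 3 :=
  - cp (brk (leg2 0 1 s) (leg2 0 2 s)).

End Tensors.

(* Main.v *)
(** The cocycle extends to the Delta-derivation of T(V) (Delta the coproduct)
    with the prescribed values on V, so d (x) id^p is a derivation along
    Delta (x) id^p.  Since d s = [s^12,s^13] - [s^21,s^23] (d in the first leg),
    the defect identity holds on generators by Jacobi; it propagates to brackets
    because the mixed terms cancel by antisymmetry.  In (d (x) id (x) id) phi_s,
    the triple commutators s^{1i}, s^{1j}, s^{1l} die under Alt by Jacobi, and
    those along a path of length three cancel in pairs of opposite sign.
    Finally, if [x, phi_s] = 0 for a basis vector x = e_p, the coefficient of
    e_p e_p e_q (x) e_r (x) e_t is, up to sign, a 2x2 minor of s. *)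
From HB Require Import structures.
Require Import Defs.
From mathcomp Require Import all_boot all_order all_fingroup all_algebra.
From mathcomp Require Import finmap.
From mathcomp.multinomials Require Import monalg.
From Stdlib Require Ncring Ncring_tac.
Set Implicit Arguments.
Unset Strict Implicit.
Unset Printing Implicit Defensive.
Import GRing.Theory.
Local Open Scope ring_scope.

(** * Commutator identities *)

(** The cocycle rule only concerns brackets of Lie elements, while computing [d (x) id] on a bracket
    of tensors such as [s^{12}] and [s^{13}] involves products that leave the tensor powers of L(V).
    A derivation defined on all of T(V) applies to such products, and this is why [cobr s] is built
    there. A cocycle in the sense of [is_delta] is any linear map on T(V) with the right restriction
    to L(V); this restriction is forced by the values on V, and [tens_id] reads only first factors,
    so on tensors over L(V) any such map may be exchanged for [cobr s]. The long computations are
    detached from tensors: legs become variables of an arbitrary noncommutative ring, the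
    commutation of disjoint legs becomes a hypothesis, and the identity is decided by normalisation.
    Characteristic zero enters in the star terms, where three equal values have sum zero. *)

Section Commutators.
Variable R : nzRingType.
Implicit Types x y z : R.
Local Notation br x y := (x * y - y * x).

(** A bridge to the noncommutative ring normaliser of the standard library, with Leibniz equality as
    its setoid equality. *)
#[local] Instance nc_ops :
  @Ncring.Ring_ops R 0 1 +%R *%R (fun x y => x - y) -%R eq := {}.
#[local] Instance nc_ring :
  @Ncring.Ring R 0 1 +%R *%R (fun x y => x - y) -%R eq nc_ops.
Proof.
split=> //; try by [move=> ? ? -> ? ? -> | move=> ? ? ->].
- exact: RelationClasses.eq_equivalence.
- exact: add0r.
- exact: addrC.
- exact: addrA.
- exact: mul1r.
- exact: mulr1.
- exact: mulrA.
- exact: mulrDl.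
- by move=> *; exact: mulrDr.
- exact: addrN.
Qed.

Local Ltac ncring :=
  intros; lazymatch goal with |- ?a = ?b =>
    change (Algebra_syntax.equality a b) end; Ncring_tac.non_commutative_ring.

Lemma commutator_addl x y z : br (x + y) z = br x z + br y z.
Proof. ncring. Qed.

Lemma commutator_subr x y z : br x (y - z) = br x y - br x z.
Proof. ncring. Qed.

Lemma commutator_prodl x y z : br x (y * z) = br x y * z + y * br x z.
Proof. ncring. Qed.

Lemma commutator_prodr x y z : br y z = 0 -> br (x * y) z = br x z * y.
Proof.
have -> : br (x * y) z = x * br y z + br x z * y by ncring.
by move=> ->; rewrite mulr0 add0r.
Qed.

Lemma commutator_prod_eq x y z y' z' :
  br x y = y' -> br x z = z' -> br x (y * z) = y' * z + y * z'.
Proof. by move=> <- <-; apply: commutator_prodl. Qed.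

(** With [x], [y] the values of a morphism and [x'], [y'] those of a derivation along it, this turns
    the Leibniz rule into the cocycle rule. *)
Lemma derivation_commutator x y x' y' :
  (x * y' + x' * y) - (y * x' + y' * x) = br x y' - br y x'.
Proof. ncring. Qed.

Lemma add_mul_eq x y z t z' t' : y = 0 -> z = z' -> t = t' -> x * y + z * t = z' * t'.
Proof. by move=> -> -> ->; rewrite mulr0 add0r. Qed.

Lemma commutator_mulr x y z : br x z = 0 -> br x y * z = br x (y * z).
Proof. by rewrite commutator_prodl => ->; rewrite mulr0 addr0. Qed.

Lemma commutator_sub_mulr x x' y y' z : br x z = 0 -> br x' z = 0 ->
  (br x y - br x' y') * z = br x (y * z) - br x' (y' * z).
Proof. by move=> xz x'z; rewrite mulrBl !commutator_mulr. Qed.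

(* The shape of (d (x) id) d x for a generator x, with x_i the legs of x and   *)
(* s_ij those of s; the 0 is d of a leg other than the first.                  *)
Definition cobr2 (s01 s02 s10 s12 s20 s21 x0 x1 x2 : R) : R :=
  br (s02 + s12) (br s01 x0 - br s10 x1) - br (x0 + x1) (br s01 s02 - br s10 s12)
  - (br (s20 + s21) 0 - br x2 (br s01 s20 - br s10 s21)).

Lemma cobr2_eq (s01 s02 s10 s12 s20 s21 x0 x1 x2 a b c d a' b' c' d' : R) :
  a = s02 + s12 -> b = br s01 x0 - br s10 x1 ->
  c = x0 + x1 -> d = br s01 s02 - br s10 s12 ->
  a' = s20 + s21 -> b' = 0 -> c' = x2 -> d' = br s01 s20 - br s10 s21 ->
  br a b - br c d - (br a' b' - br c' d') = cobr2 s01 s02 s10 s12 s20 s21 x0 x1 x2.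
Proof. by move=> -> -> -> -> -> -> -> ->. Qed.

Lemma cobr2_congr (s01 s02 s10 s12 s20 s21 x0 x1 x2 : R)
    (t01 t02 t10 t12 t20 t21 y0 y1 y2 : R) :
  s01 = t01 -> s02 = t02 -> s10 = t10 -> s12 = t12 -> s20 = t20 -> s21 = t21 ->
  x0 = y0 -> x1 = y1 -> x2 = y2 ->
  cobr2 s01 s02 s10 s12 s20 s21 x0 x1 x2 = cobr2 t01 t02 t10 t12 t20 t21 y0 y1 y2.
Proof. by move=> -> -> -> -> -> -> -> -> ->. Qed.

(* Jacobi; the hypotheses say that disjoint legs commute.                      *)
Lemma cobr2_cyclic (s01 s02 s10 s12 s20 s21 x0 x1 x2 : R) :
  br s12 x0 = 0 -> br s21 x0 = 0 -> br s20 x1 = 0 -> br s02 x1 = 0 ->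
  br s01 x2 = 0 -> br s10 x2 = 0 ->
  cobr2 s01 s02 s10 s12 s20 s21 x0 x1 x2
  + cobr2 s12 s10 s21 s20 s01 s02 x1 x2 x0
  + cobr2 s20 s21 s02 s01 s12 s10 x2 x0 x1
  = br (x0 + x1 + x2) (- (br s01 s02 + br s12 s10 + br s20 s21)).
Proof.
move=> s12x0 s21x0 s20x1 s02x1 s01x2 s10x2.
transitivity (br (x0 + x1 + x2) (- (br s01 s02 + br s12 s10 + br s20 s21))
  + (br s01 (br s12 x0) - br s02 (br s21 x0) + br s12 (br s20 x1)
     - br s10 (br s02 x1) + br s20 (br s01 x2) - br s21 (br s10 x2))).
  rewrite /cobr2; ncring.
by rewrite s12x0 s21x0 s20x1 s02x1 s01x2 s10x2 !(mulr0, mul0r, subrr, addr0).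
Qed.

(* The shape of (d (x) id) d [x, y]: X and Y are the diagonal images of x and  *)
(* y, a and b the legs of d x and d y, and ex and ey stand for (d (x) id) d x  *)
(* and (d (x) id) d y.                                                         *)
Definition bracket_term (X ey b02 b12 a01 Y ex a02 a12 b01 : R) : R :=
  br X ey - br (b02 + b12) a01 - (br Y ex - br (a02 + a12) b01).

Lemma bracket_term_eq (X ey b02 b12 a01 Y ex a02 a12 b01 X' b a Y' a' b' : R) :
  X' = X -> b = b02 + b12 -> a = a01 -> Y' = Y -> a' = a02 + a12 -> b' = b01 ->
  br X' ey - br b a - (br Y' ex - br a' b')
  = bracket_term X ey b02 b12 a01 Y ex a02 a12 b01.
Proof. by move=> -> -> -> -> -> ->. Qed.

Lemma bracket_term_congr (X b02 b12 a01 Y a02 a12 b01 : R)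
    (X' b02' b12' a01' Y' a02' a12' b01' ex ey : R) :
  X = X' -> b02 = b02' -> b12 = b12' -> a01 = a01' ->
  Y = Y' -> a02 = a02' -> a12 = a12' -> b01 = b01' ->
  bracket_term X ey b02 b12 a01 Y ex a02 a12 b01
  = bracket_term X' ey b02' b12' a01' Y' ex a02' a12' b01'.
Proof. by move=> -> -> -> -> -> -> -> ->. Qed.

(* The mixed terms cancel because a = cobr x and b = cobr y are antisymmetric. *)
Lemma defect_bracket (X Y phi ex0 ex1 ex2 ey0 ey1 ey2 : R)
    (a01 a12 a20 a10 a21 a02 b01 b12 b20 b10 b21 b02 : R) :
  a10 = - a01 -> a21 = - a12 -> a02 = - a20 ->
  b10 = - b01 -> b21 = - b12 -> b02 = - b20 ->
  ex0 + ex1 + ex2 = br X phi -> ey0 + ey1 + ey2 = br Y phi ->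
  bracket_term X ey0 b02 b12 a01 Y ex0 a02 a12 b01
  + bracket_term X ey1 b10 b20 a12 Y ex1 a10 a20 b12
  + bracket_term X ey2 b21 b01 a20 Y ex2 a21 a01 b20
  = br (br X Y) phi.
Proof.
move=> -> -> -> -> -> -> eX eY.
have -> : br (br X Y) phi = br X (br Y phi) - br Y (br X phi) by ncring.
rewrite -eX -eY /bracket_term; ncring.
Qed.

Lemma commutator_pair (a a' b b' : R) :
  br a b' = 0 -> br b a' = 0 -> br b b' = 0 ->
  br (a * b) (a' * b') = br a a' * b * b'.
Proof.
move=> ab' ba' bb'.
have -> : br (a * b) (a' * b') =
  br a a' * b * b' + a * br b a' * b' + a' * br a b' * b + a' * a * br b b'.
  ncring.
by rewrite ab' ba' bb' !(mulr0, mul0r, addr0).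
Qed.

Lemma mulr_rotl x y z : x * y = y * x -> x * z = z * x -> x * y * z = y * z * x.
Proof. by move=> xy xz; rewrite xy -!mulrA xz. Qed.

Lemma commutator_cyclicr x y z :
  br x (br y z) + br y (br z x) + br z (br x y) = 0.
Proof. ncring. Qed.

(** Jacobi for a path of three edges: the end edges [x] and [y] commute, so either one can be made
    the outer entry, up to sign. *)
Lemma commutator_swap x y z : br x y = 0 -> br x (br y z) = - br y (br z x).
Proof.
move=> xy; have -> : br x (br y z) = br (br x y) z - br y (br z x) by ncring.
by rewrite xy mul0r mulr0 subrr sub0r.
Qed.

Lemma commutator_sum3 x y z t :
  br (x + y + z) t = x * t + y * t + z * t - (t * x + t * y + t * z).
Proof. by rewrite !mulrDl !mulrDr. Qed.

Lemma derivation_assoc (a a' x x' y y' : R) :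
  a * (x * y' + x' * y) + a' * (x * y) = (a * x) * y' + (a * x' + a' * x) * y.
Proof. ncring. Qed.

Lemma mulr_interchange (x x' y y' : R) :
  x' * y = y * x' -> (x * x') * (y * y') = (x * y) * (x' * y').
Proof. by move=> xy; rewrite -!mulrA [x' * _]mulrA xy !mulrA. Qed.

End Commutators.

Lemma cobr2_morph (R R' : nzRingType) (f : {rmorphism R -> R'})
    (s01 s02 s10 s12 s20 s21 x0 x1 x2 : R) :
  f (cobr2 s01 s02 s10 s12 s20 s21 x0 x1 x2) =
  cobr2 (f s01) (f s02) (f s10) (f s12) (f s20) (f s21) (f x0) (f x1) (f x2).
Proof. by rewrite /cobr2 !(rmorphB, rmorphD, rmorphM, rmorph0). Qed.

Lemma scale_linear (k : fieldType) (M : lmodType k) e c (x y : M) :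
  e *: (c *: x + y) = c *: (e *: x) + e *: y.
Proof. by rewrite scalerDr !scalerA mulrC. Qed.

Lemma sum_ord2 (M : nmodType) (F : 'I_2 -> M) : \sum_(i < 2) F i = F 0 + F 1.
Proof. by rewrite big_ord_recl big_ord1; congr (F _ + F _); apply/val_inj. Qed.

Lemma sum_ord3 (M : nmodType) (F : 'I_3 -> M) :
  \sum_(i < 3) F i = F 0 + F 1 + F 2.
Proof.
rewrite !big_ord_recl big_ord0 addr0 addrA.
by congr (F _ + F _ + F _); apply/val_inj.
Qed.

Lemma prod_ord2 (R : nzRingType) (F : 'I_2 -> R) : \prod_(i < 2) F i = F 0 * F 1.
Proof. by rewrite big_ord_recl big_ord1; congr (F _ * F _); apply/val_inj. Qed.

Lemma prod_ord3 (R : nzRingType) (F : 'I_3 -> R) :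
  \prod_(i < 3) F i = F 0 * F 1 * F 2.
Proof.
rewrite !big_ord_recl big_ord0 mulr1 mulrA.
by congr (F _ * F _ * F _); apply/val_inj.
Qed.

Lemma scale_sub_interchange (k : fieldType) (M : lmodType k) c (x y x' y' : M) :
  (c *: x + y) - (c *: x' + y') = c *: (x - x') + (y - y').
Proof. by rewrite scalerBr opprD addrACA. Qed.

Lemma bracket_term_morph (R R' : nzRingType) (f : {rmorphism R -> R'})
    (X ey b02 b12 a01 Y ex a02 a12 b01 : R) :
  f (bracket_term X ey b02 b12 a01 Y ex a02 a12 b01) =
  bracket_term (f X) (f ey) (f b02) (f b12) (f a01)
    (f Y) (f ex) (f a02) (f a12) (f b01).
Proof. by rewrite /bracket_term !(rmorphB, rmorphD, rmorphM). Qed.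

(** The sum is [3 x], and 3 is invertible in characteristic zero. *)
Lemma cyclic_sum_eq0 (k : fieldType) (M : lmodType k) (x y z : M) :
  [pchar k] =i pred0 -> y = x -> z = y -> x + y + z = 0 -> x = 0.
Proof.
move=> char0 -> ->; rewrite -[x in _ + x]mulr1n -mulr2n -mulrSr -scaler_nat.
by move/eqP; rewrite scaler_eq0 ((pcharf0P k).1 char0) => /eqP.
Qed.

Lemma additive_single (M M' : zmodType) (f : {additive M -> M'})
    (a b c a' b' c' : M) :
  f b = 0 -> f c = 0 -> f a' = 0 -> f b' = 0 -> f c' = 0 ->
  f (a + b + c - (a' + b' + c')) = f a.
Proof.
by move=> b0 c0 a0' b0' c0'; rewrite raddfB !(raddfD f) b0 c0 a0' b0' c0' !addr0 subr0.
Qed.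

Lemma additive_singleN (M M' : zmodType) (f : {additive M -> M'}) (a b c : M) z :
  f a = z -> f b = 0 -> f c = 0 -> f (- (a + b + c)) = - z.
Proof. by move=> az b0 c0; rewrite raddfN !(raddfD f) az b0 c0 !addr0. Qed.

Lemma opp_sum3_eq0 (M : zmodType) (a b c : M) :
  a = 0 -> b = 0 -> c = 0 -> - (a + b + c) = 0.
Proof. by move=> -> -> ->; rewrite !addr0 oppr0. Qed.

Lemma double_delta (R : nzRingType) n (F : 'I_n -> 'I_n -> R) (p q : 'I_n) :
  \sum_a \sum_b ((a == p) && (b == q))%:R * F a b = F p q.
Proof.
rewrite (bigD1 p) //= (bigD1 q) //= !eqxx mul1r big1 => [|b /negPf ->]; last first.
  by rewrite mul0r.
rewrite addr0 big1 ?addr0 // => a /negPf ->.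
by rewrite big1 // => b _; rewrite mul0r.
Qed.

Lemma additive_opp_sum3 (M M' : zmodType) (f : {additive M -> M'})
    (b0 b1 b2 : M) (c0 c1 c2 c : M') :
  f b0 = - c0 -> f b1 = - c1 -> f b2 = - c2 ->
  c0 + c1 + c2 = c -> f (- (b0 + b1 + b2)) = c.
Proof.
by move=> e0 e1 e2 <-; rewrite raddfN !(raddfD f) e0 e1 e2 !opprD !opprK.
Qed.

(* The twelve triple commutators of (d (x) id (x) id) phi_s: four stars, and   *)
(* eight paths that cancel. The terms in x and y carry d of legs other than    *)
(* the first.                                                                  *)
Lemma alt_defect (R : nzRingType) (M : zmodType) (f : {additive R -> M}) (b : M)
    (s01 s02 s03 s10 s12 s13 s20 s21 s23 s30 s31 s32 x y : R) :
  let br (u v : R) := u * v - v * u in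
  f (br s02 (br s01 s03)) = 0 -> f (br s12 (br s10 s13)) = 0 ->
  f (br s03 (br s01 s02)) = 0 -> f (br s13 (br s10 s12)) = 0 ->
  f (br s12 (br s01 s03)) = b -> f (br s02 (br s10 s13)) = - b ->
  f (br s13 (br s01 s02)) = - b -> f (br s03 (br s10 s12)) = b ->
  f (br s23 (br s01 s20)) = - b -> f (br s23 (br s10 s21)) = b ->
  f (br s32 (br s01 s30)) = b -> f (br s32 (br s10 s31)) = - b ->
  f (- (br (s02 + s12) (br s01 s03 - br s10 s13)
        - br (s03 + s13) (br s01 s02 - br s10 s12)
        + (br s23 (br s01 s20 - br s10 s21) - br x 0)
        + (br y 0 - br s32 (br s01 s30 - br s10 s31)))) = 0.
Proof.
move=> br e1 e2 e3 e4 e5 e6 e7 e8 e9 e10 e11 e12.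
have brDl u v w : br (u + v) w = br u w + br v w by exact: commutator_addl.
have brBr u v w : br u (v - w) = br u v - br u w by exact: commutator_subr.
have br0 u : br u 0 = 0 by rewrite /br mulr0 mul0r subrr.
(* With [br] opaque, the expansion stops at the twelve triple commutators and does not break them
   into products. *)
clearbody br; rewrite !brDl !brBr !br0 !(raddfN f, raddfB f, raddfD f, raddf0 f).
rewrite e1 e2 e3 e4 e5 e6 e7 e8 e9 e10 e11 e12.
by rewrite !(oppr0, subr0, sub0r, addr0, opprK) -!opprD opprK !addrK add0r subrr oppr0.
Qed.

(** * The tensor powers of T(V) *)

Section LinExt.
Variables (k : fieldType) (V : vectType k).
Local Notation n := (\dim {:V}).

Lemma tens_sum m (t : tens V m) : t = \sum_(w <- msupp t) t@_w *: mono w.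
Proof.
rewrite {1}[t]monalgE; apply: eq_bigr => w _; apply/malgP => u.
by rewrite mcoeffZ !mcoeffU mulr_natr.
Qed.

Lemma tens_ind m (P : tens V m -> Prop) :
  P 0 -> (forall x y, P x -> P y -> P (x + y)) ->
  (forall c x, P x -> P (c *: x)) -> (forall w, P (mono w)) ->
  forall t, P t.
Proof.
by move=> P0 PD PZ Pm t; rewrite [t]tens_sum; apply: big_ind => // w _; exact: PZ.
Qed.

(** The supports of [x], [y] and [c *: x + y] differ; enlarging the index set lets the three sums in
    the proof of linearity run over the same words. *)
Lemma lin_ext_w m m' (f : mword n m -> tens V m') (d : {fset mword n m})
    (t : tens V m) : (msupp t `<=` d)%fset ->
  lin_ext f t = \sum_(w <- d) t@_w *: f w.
Proof.
move=> le_td; rewrite /lin_ext (big_fset_incl _ le_td) // => w _ /mcoeff_outdom ->.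
by rewrite scale0r.
Qed.

Fact lin_ext_is_linear m m' (f : mword n m -> tens V m') : linear (lin_ext f).
Proof.
move=> c x y.
have le_d : (msupp (c *: x + y)%R `<=` msupp x `|` msupp y)%fset.
  apply: (fsubset_trans (msuppD_le _ _)).
  exact: fsetSU (msuppZ_le _ _).
rewrite !(lin_ext_w f le_d, lin_ext_w f (fsubsetUl _ _), lin_ext_w f (fsubsetUr _ _)).
rewrite (lin_ext_w f (fsubsetUl (msupp x) (msupp y))).
rewrite (lin_ext_w f (fsubsetUr (msupp x) (msupp y))).
rewrite scaler_sumr -big_split /=; apply: eq_bigr => w _.
by rewrite mcoeffD mcoeffZ scalerDl scalerA.
Qed.

HB.instance Definition _ m m' (f : mword n m -> tens V m') :=
  GRing.isLinear.Build k (tens V m) (tens V m') _ (lin_ext f)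
    (lin_ext_is_linear f).

Lemma lin_ext_mono m m' (f : mword n m -> tens V m') w :
  lin_ext f (mono w) = f w.
Proof.
have le_w : (msupp (mono w) `<=` [fset w])%fset by exact: msuppU_le.
by rewrite (lin_ext_w f le_w) big_seq_fset1 mcoeffUU scale1r.
Qed.

HB.instance Definition _ m m' (f : 'I_m -> 'I_m') :=
  GRing.Linear.copy (@place k V m m' f) (lin_ext _).
HB.instance Definition _ m (i : 'I_m) :=
  GRing.Linear.copy (@leg k V m i) (place _).
HB.instance Definition _ m (i j : 'I_m) :=
  GRing.Linear.copy (@leg2 k V m i j) (place _).
HB.instance Definition _ p (d : tens V 1 -> tens V 2) :=
  GRing.Linear.copy (@tens_id k V p d) (lin_ext _).

Lemma lin_eq m m' (f g : {linear tens V m -> tens V m'}) :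
  (forall w, f (mono w) = g (mono w)) -> f =1 g.
Proof.
move=> fg; elim/tens_ind => [|x y IHx IHy|c x IHx|//].
- by rewrite !linear0.
- by rewrite !linearD IHx IHy.
- by rewrite !linearZ IHx.
Qed.

(** The structure declared on [tens] is that of a left algebra. The rule on the right follows from
    the centrality of [c *: 1], which is supported on the tuple of empty words. *)
Lemma scalerAr_tens m c (x y : tens V m) : c *: (x * y) = x * (c *: y).
Proof.
have scaleM z : z * (c *: 1) = c *: z :> tens V m.
  elim/tens_ind: z => [|u v IHu IHv|a u IHu|w].
  - by rewrite mul0r scaler0.
  - by rewrite mulrDl IHu IHv scalerDr.
  - by rewrite -scalerAl IHu !scalerA mulrC.
  - have -> : c *: 1 = << c *g mone >> :> tens V m.
      by apply/malgP => u; rewrite mcoeffZ !mcoeffU mulr_natr.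
    rewrite /mono malgM_def fgmulUU mulm1 mul1r.
    by apply/malgP => u; rewrite mcoeffZ !mcoeffU mulr_natr.
by rewrite -[in RHS](mul1r y) [c *: (1 * y)]scalerAl mulrA scaleM scalerAl.
Qed.

Lemma monoM m (u v : mword n m) : mono u * mono v = mono (mmul u v).
Proof. by rewrite /mono malgM_def fgmulUU mulr1. Qed.

Lemma mono1 m : mono (mone : mword n m) = 1.
Proof. by []. Qed.

(** Linearity is assumed in each argument, not inferred, so that composites such as
    [place f (x * y)] can be used directly; the structures are packed on the spot to reach
    [lin_eq]. *)
Lemma bilinear_eq m m' m'' (F G : tens V m -> tens V m' -> tens V m'') :
  (forall y, linear (F^~ y)) -> (forall x, linear (F x)) ->
  (forall y, linear (G^~ y)) -> (forall x, linear (G x)) ->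
  (forall u v, F (mono u) (mono v) = G (mono u) (mono v)) -> F =2 G.
Proof.
move=> Fl Fr Gl Gr FG x y.
pose F' y := GRing.isLinear.Build k (tens V m) (tens V m'') _ (F^~ y) (Fl y).
pose G' y := GRing.isLinear.Build k (tens V m) (tens V m'') _ (G^~ y) (Gl y).
pose Fy y : {linear tens V m -> tens V m''} := HB.pack (F^~ y) (F' y).
pose Gy y : {linear tens V m -> tens V m''} := HB.pack (G^~ y) (G' y).
apply: (@lin_eq m m'' (Fy y) (Gy y)) x => u /=.
pose F'' := GRing.isLinear.Build k (tens V m') (tens V m'') _ (F (mono u)) (Fr _).
pose G'' := GRing.isLinear.Build k (tens V m') (tens V m'') _ (G (mono u)) (Gr _).
pose Fu : {linear tens V m' -> tens V m''} := HB.pack (F (mono u)) F''.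
pose Gu : {linear tens V m' -> tens V m''} := HB.pack (G (mono u)) G''.
by apply: (@lin_eq m' m'' Fu Gu) => v; apply: FG.
Qed.

Lemma tens_mulDl m (x y z : tens V m) : (x + y) * z = x * z + y * z.
Proof. exact: mulrDl. Qed.

Lemma mulr_linearl m (c : k) (x x' y : tens V m) :
  (c *: x + x') * y = c *: (x * y) + x' * y.
Proof. by rewrite mulrDl -scalerAl. Qed.

Lemma mulr_linearr m (c : k) (x y y' : tens V m) :
  x * (c *: y + y') = c *: (x * y) + x * y'.
Proof. by rewrite mulrDr -scalerAr_tens. Qed.

Lemma mulr_linearl2 m (c : k) (x x' y y' a b : tens V m) :
  (c *: x + x') * a + (c *: y + y') * b
  = c *: (x * a + y * b) + (x' * a + y' * b).
Proof. by rewrite (mulr_linearl c x) (mulr_linearl c y) scalerDr addrACA. Qed.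

Lemma mulr_linearr2 m (c : k) (x x' y y' a b : tens V m) :
  a * (c *: x + x') + b * (c *: y + y')
  = c *: (a * x + b * y) + (a * x' + b * y').
Proof. by rewrite (mulr_linearr c a x) (mulr_linearr c b y) scalerDr addrACA. Qed.

End LinExt.

(** * Placing tensor factors, and commutation of disjoint legs *)

Section Place.
Variables (k : fieldType) (V : vectType k).
Local Notation n := (\dim {:V}).
Local Notation T := (tens V 1).

Lemma place_mono m m' (f : 'I_m -> 'I_m') (w : mword n m) :
  place f (mono w : tens V m) = mono [ffun j =>
    if [pick i | f i == j] is Some i then w i else [::]].
Proof. exact: lin_ext_mono. Qed.

Lemma eq_place m m' (f g : 'I_m -> 'I_m') : f =1 g ->
  place f =1 place g :> (tens V m -> tens V m').
Proof.
move=> fg; apply: lin_eq => w; rewrite /= !place_mono.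
congr mono; apply/ffunP => j; rewrite !ffunE.
by under eq_pick => i do rewrite fg.
Qed.

Lemma place_id m (f : 'I_m -> 'I_m) (t : tens V m) : f =1 id -> place f t = t.
Proof.
move=> f_id; suff: place f =1 idfun :> (tens V m -> _) by apply.
apply: lin_eq => w; rewrite /= place_mono.
congr mono; apply/ffunP => j; rewrite !ffunE.
by case: pickP => [i /eqP <-|/(_ j)]; rewrite f_id ?eqxx.
Qed.

Section PlaceLinear.
Variables (m m' : nat) (f : 'I_m -> 'I_m').
Implicit Types x y : tens V m.

Lemma place0 : place f (0 : tens V m) = 0. Proof. exact: linear0. Qed.
Lemma placeD x y : place f (x + y) = place f x + place f y.
Proof. exact: linearD. Qed.
Lemma placeN x : place f (- x) = - place f x. Proof. exact: linearN. Qed.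
Lemma placeB x y : place f (x - y) = place f x - place f y.
Proof. exact: linearB. Qed.
End PlaceLinear.

Lemma place1 m m' (f : 'I_m -> 'I_m') : place f (1 : tens V m) = 1.
Proof.
rewrite -mono1 place_mono -mono1; congr mono.
by apply/ffunP => j; rewrite !ffunE; case: pickP => *; rewrite ?ffunE.
Qed.

Lemma placeP m m' (f : 'I_m -> 'I_m') c (x y : tens V m) :
  place f (c *: x + y) = c *: place f x + place f y.
Proof. exact: linearP. Qed.

(** Position [j] reads the same index (or none) in every tuple of words, so placing commutes with
    concatenation position by position. *)
Lemma placeM m m' (f : 'I_m -> 'I_m') (x y : tens V m) :
  place f (x * y) = place f x * place f y.
Proof.
pose F (x y : tens V m) := place f (x * y).
pose G (x y : tens V m) := place f x * place f y.
suff : F =2 G by apply.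
apply: bilinear_eq; rewrite /F /G.
- by move=> b c x1 x2; rewrite mulr_linearl placeP.
- by move=> b c x1 x2; rewrite mulr_linearr placeP.
- by move=> b c x1 x2; rewrite placeP mulr_linearl.
- by move=> b c x1 x2; rewrite placeP mulr_linearr.
move=> u v; rewrite monoM !place_mono monoM; congr mono.
by apply/ffunP => j; rewrite !ffunE; case: pickP => *; rewrite ?ffunE.
Qed.

HB.instance Definition _ m m' (f : 'I_m -> 'I_m') :=
  GRing.isMonoidMorphism.Build (tens V m) (tens V m') (place f)
    (conj (place1 f) (@placeM m m' f)).

Lemma place_brk m m' (f : 'I_m -> 'I_m') (x y : tens V m) :
  place f (brk x y) = brk (place f x) (place f y).
Proof. by rewrite /brk (placeB _ (x * y)) (placeM f x) (placeM f y). Qed.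

(** For injective [g], the conditions [g (f l) == g i] and [f l == i] agree, so the two nested
    choices of an index amount to the single one. *)
Lemma place_comp m m' m'' (f : 'I_m -> 'I_m') (g : 'I_m' -> 'I_m'')
    (t : tens V m) : injective g -> place g (place f t) = place (g \o f) t.
Proof.
move=> g_inj; suff: place g \o place f =1 place (g \o f) :> (tens V m -> _) by apply.
apply: lin_eq => w; rewrite /= !place_mono.
congr mono; apply/ffunP => j; rewrite !ffunE.
case: pickP => [i /eqP <-|no_i].
  by rewrite ffunE; under [in RHS]eq_pick => l do rewrite /= inj_eq //.
by case: pickP => // i; rewrite /= no_i.
Qed.

Lemma place_leg m m' (g : 'I_m -> 'I_m') (i : 'I_m) (x : T) :
  injective g -> place g (leg i x) = leg (g i) x.
Proof. exact: place_comp. Qed.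

Lemma place_leg2 m m' (g : 'I_m -> 'I_m') (i j : 'I_m) (t : tens V 2) :
  injective g -> place g (leg2 i j t) = leg2 (g i) (g j) t.
Proof.
move=> g_inj; rewrite /leg2 (place_comp _ t g_inj).
have eq_g : g \o (fun a : 'I_2 => if a == 0 then i else j)
            =1 (fun a => if a == 0 then g i else g j).
  by move=> a /=; case: (a == 0).
exact: eq_place eq_g t.
Qed.

Lemma pair_inj m (i j : 'I_m) : i != j ->
  injective (fun a : 'I_2 => if a == 0 then i else j).
Proof.
move=> neq_ij a b; have ord2 (c : 'I_2) : c != 0 -> c = 1.
  by case: c => [[|[|?]] ?] //= _; apply/val_inj.
case: (eqVneq a 0) (eqVneq b 0) => [->|/ord2 ->] [->|/ord2 ->] // /eqP.
  by rewrite (negPf neq_ij).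
by rewrite eq_sym (negPf neq_ij).
Qed.

Lemma leg2_leg m (i j : 'I_m) (a : 'I_2) (x : T) : i != j ->
  leg2 i j (leg a x) = leg (if a == 0 then i else j) x.
Proof. by move=> neq_ij; apply: place_comp; apply: pair_inj. Qed.

Lemma leg2_leg2 m (i j : 'I_m) (a b : 'I_2) (t : tens V 2) : i != j ->
  leg2 i j (leg2 a b t) = leg2 (if a == 0 then i else j) (if b == 0 then i else j) t.
Proof. by move=> neq_ij; apply: place_leg2; apply: pair_inj. Qed.

Lemma leg2_flip m (i j : 'I_m) (t : tens V 2) : i != j ->
  leg2 i j (flip t) = leg2 j i t.
Proof. exact: leg2_leg2. Qed.

Lemma leg2_id (t : tens V 2) : leg2 0 1 t = t.
Proof. by apply: place_id => -[[|[|?]] ?] //=; apply/val_inj. Qed.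

(** At every position one of the two words is empty, so the order of concatenation is immaterial. *)
Lemma place_disjoint m m1 m2 (f : 'I_m1 -> 'I_m) (g : 'I_m2 -> 'I_m)
    (x : tens V m1) (y : tens V m2) :
  (forall a b, f a != g b) -> brk (place f x) (place g y) = 0.
Proof.
move=> dis; apply/eqP; rewrite subr_eq0; apply/eqP.
pose F (x : tens V m1) (y : tens V m2) := place f x * place g y.
pose G (x : tens V m1) (y : tens V m2) := place g y * place f x.
suff : F =2 G by apply.
apply: bilinear_eq; rewrite /F /G.
- by move=> b c x1 x2; rewrite placeP mulr_linearl.
- by move=> b c x1 x2; rewrite placeP mulr_linearr.
- by move=> b c x1 x2; rewrite placeP mulr_linearr.
- by move=> b c x1 x2; rewrite placeP mulr_linearl.
move=> u v; rewrite !place_mono !monoM; congr mono.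
apply/ffunP => j; rewrite !ffunE.
case: pickP => [a /eqP fa|_]; last by rewrite cats0.
by case: pickP => [b /eqP gb|_]; [case/eqP: (dis a b); rewrite fa | rewrite cats0].
Qed.

Lemma brk_leg m (i j : 'I_m) (x y : T) : i != j -> brk (leg i x) (leg j y) = 0.
Proof. by move=> neq_ij; apply: place_disjoint. Qed.

Lemma brk_leg2_leg m (i j l : 'I_m) (t : tens V 2) (x : T) :
  i != l -> j != l -> brk (leg2 i j t) (leg l x) = 0.
Proof. by move=> ? ?; apply: place_disjoint => a b; case: ifP. Qed.

Lemma brk_leg2 m (i j l h : 'I_m) (t u : tens V 2) :
  i != l -> j != l -> i != h -> j != h -> brk (leg2 i j t) (leg2 l h u) = 0.
Proof. by move=> *; apply: place_disjoint => a b; do 2!case: ifP => _. Qed.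

Lemma leg_brk m (i : 'I_m) (x y : T) : leg i (brk x y) = brk (leg i x) (leg i y).
Proof. exact: place_brk. Qed.

Lemma leg1 m (i : 'I_m) : leg i (1 : T) = 1.
Proof. exact: place1. Qed.

Section Brk.
Variable m : nat.
Implicit Types x y z : tens V m.

Lemma brk0l x : brk 0 x = 0. Proof. by rewrite /brk mul0r mulr0 subr0. Qed.
Lemma brk0r x : brk x 0 = 0. Proof. by rewrite /brk mul0r mulr0 subr0. Qed.
Lemma brkxx x : brk x x = 0. Proof. exact: subrr. Qed.
Lemma brkC x y : brk x y = - brk y x. Proof. by rewrite /brk opprB. Qed.
Lemma brkDl x y z : brk (x + y) z = brk x z + brk y z.
Proof. by rewrite /brk mulrDl mulrDr opprD addrACA. Qed.
Lemma brkDr x y z : brk x (y + z) = brk x y + brk x z.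
Proof. by rewrite /brk mulrDl mulrDr opprD addrACA. Qed.
Lemma brkNr x y : brk x (- y) = - brk x y.
Proof. by rewrite /brk mulNr mulrN opprB opprK addrC. Qed.
Lemma brkZr c x y : brk x (c *: y) = c *: brk x y.
Proof. by rewrite /brk -scalerAl -scalerAr_tens -scalerBr. Qed.
Lemma brkP c x y z : brk x (c *: y + z) = c *: brk x y + brk x z.
Proof. by rewrite brkDr brkZr. Qed.
Lemma brk_suml I (r : seq I) (F : I -> tens V m) y :
  brk (\sum_(i <- r) F i) y = \sum_(i <- r) brk (F i) y.
Proof. by rewrite /brk mulr_suml mulr_sumr -sumrB. Qed.
Lemma brk_sumr I (r : seq I) (F : I -> tens V m) y :
  brk y (\sum_(i <- r) F i) = \sum_(i <- r) brk y (F i).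
Proof. by rewrite /brk mulr_suml mulr_sumr -sumrB. Qed.
Lemma brk0_comm x y : brk x y = 0 -> x * y = y * x.
Proof. by move/eqP; rewrite subr_eq0 => /eqP. Qed.
End Brk.

Lemma place_diag m (p : 'S_m) (x : T) : place p (diag m x) = diag m x.
Proof.
rewrite /diag linear_sum [RHS](reindex_inj (@perm_inj _ p)) /=.
by apply: eq_bigr => i _; rewrite place_leg //; apply: perm_inj.
Qed.

Fact diag_is_linear m : linear (@diag k V m).
Proof.
move=> c x y; rewrite /diag scaler_sumr -big_split /=.
by apply: eq_bigr => i _; rewrite linearP.
Qed.

HB.instance Definition _ m :=
  GRing.isLinear.Build k (tens V 1) (tens V m) _ (@diag k V m) (@diag_is_linear m).

Lemma brk_diag m (x y : T) : diag m (brk x y) = brk (diag m x) (diag m y).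
Proof.
rewrite /diag brk_suml; apply: eq_bigr => i _.
rewrite brk_sumr (bigD1 i) //= big1 ?addr0 ?leg_brk // => j.
by rewrite eq_sym => /brk_leg.
Qed.

Lemma brk_diag_leg m (i : 'I_m) (x y : T) :
  brk (diag m x) (leg i y) = leg i (brk x y).
Proof.
by rewrite /diag brk_suml (bigD1 i) //= big1 ?addr0 ?leg_brk // => j /brk_leg.
Qed.

End Place.

(** * Applying a map to the first tensor factor *)

Section TensId.
Variables (k : fieldType) (V : vectType k).
Local Notation n := (\dim {:V}).
Local Notation T := (tens V 1).

Local Notation lplace p := (@place k V 2 p.+2 (@lshift 2 p)).
Local Notation rplace p := (@place k V p p.+2 (@rshift 2 p)).

Lemma tens_id_mono p (d : T -> tens V 2) (w : mword n p.+1) :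
  tens_id d (mono w) =
    lplace p (d (mono [ffun=> w ord0])) *
    rplace p (mono [ffun i => w (lift ord0 i)]).
Proof. exact: lin_ext_mono. Qed.

Lemma tens_idP p (d : T -> tens V 2) c (x y : tens V p.+1) :
  tens_id d (c *: x + y) = c *: tens_id d x + tens_id d y.
Proof. exact: linearP. Qed.

Lemma legP m (i : 'I_m) c (x y : T) : leg i (c *: x + y) = c *: leg i x + leg i y.
Proof. exact: linearP. Qed.

(** This frees [tens_id] from words: by [pureS], every pure tensor is such a product of a first leg
    and a tensor in the later legs. *)
Lemma tens_id_split p (d : {linear T -> tens V 2}) (x : T) (y : tens V p) :
  tens_id d (leg ord0 x * place (lift ord0) y) =
  lplace p (d x) * rplace p y.
Proof.
pose F (x : T) (y : tens V p) : tens V p.+2 := tens_id d (leg ord0 x * place (lift ord0) y).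
pose G (x : T) (y : tens V p) : tens V p.+2 :=
  lplace p (d x) * rplace p y.
suff : F =2 G by apply.
apply: bilinear_eq; rewrite /F /G.
- by move=> b c x1 x2; rewrite legP mulr_linearl tens_idP.
- by move=> b c x1 x2; rewrite placeP mulr_linearr tens_idP.
- by move=> b c x1 x2; rewrite (linearP d) placeP mulr_linearl.
- by move=> b c x1 x2; rewrite placeP mulr_linearr.
move=> u v; rewrite /leg (place_mono (fun=> ord0)) (place_mono (lift ord0)) monoM tens_id_mono.
set w := mmul _ _.
have -> : [ffun=> w ord0] = u.
  apply/ffunP => i; rewrite !ffunE (ord1 i).
  case: pickP => [j _|/(_ ord0)]; last by rewrite eqxx.
  case: pickP => [j' /eqP e'|_]; last by rewrite cats0 (ord1 j).
  by have := congr1 val e'.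
suff -> : [ffun i => w (lift ord0 i)] = v by [].
apply/ffunP => i; rewrite !ffunE.
case: pickP => [j /eqP e|_]; first by have := congr1 val e.
by case: pickP => [j /eqP/lift_inj ->|/(_ i)] //; rewrite eqxx.
Qed.

Lemma leg_leg0 p (x : T) : leg ord0 x = leg ord0 x * place (lift ord0) (1 : tens V p).
Proof. by rewrite place1 mulr1. Qed.

Lemma tens_id_leg0 p (d : {linear T -> tens V 2}) (x : T) :
  tens_id d (leg (ord0 : 'I_p.+1) x) = lplace p (d x).
Proof. by rewrite leg_leg0 tens_id_split place1 mulr1. Qed.

(** The first factor here is [1]. Later legs are therefore preserved by the coproduct, where
    [d 1 = 1], and killed by the cobracket, where [d 1 = 0]. *)
Lemma tens_id_lift p (d : {linear T -> tens V 2}) (y : tens V p) :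
  tens_id d (place (lift ord0) y) =
  lplace p (d 1) * rplace p y.
Proof. by rewrite -tens_id_split leg1 mul1r. Qed.

Lemma pureS p (a : 'I_p.+1 -> T) :
  pure a = leg ord0 (a ord0) * place (lift ord0) (pure (fun i => a (lift ord0 i))).
Proof.
rewrite /pure big_ord_recl; congr (_ * _).
rewrite (big_morph _ (@placeM _ _ _ _ _) (place1 _ _)).
by apply: eq_bigr => i _; rewrite place_leg //; apply: lift_inj.
Qed.

(** Only first factors are fed to [d], and they can be taken in [L]. Results for [cobr s] pass in
    this way to every representative of the cocycle. *)
Lemma tens_id_restrict p (L : T -> Prop) (d d' : {linear T -> tens V 2})
    (t : tens V p.+1) :
  (forall x, L x -> d x = d' x) -> tensor_power L t -> tens_id d t = tens_id d' t.
Proof.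
move=> dd' [N [a [La ->]]]; rewrite !linear_sum; apply: eq_bigr => j _ /=.
by rewrite pureS !tens_id_split dd'.
Qed.

Section Derivation.
Variables (D d : {linear T -> tens V 2}) (p : nat).
Hypothesis DM : forall x y : T, D (x * y) = D x * D y.
Hypothesis dM : forall x y : T, d (x * y) = D x * d y + d x * D y.

Let head (w : mword n p.+1) : T := mono [ffun=> w ord0].
Let tail (w : mword n p.+1) : tens V p := mono [ffun i => w (lift ord0 i)].

Let headM (u v : mword n p.+1) : head (mmul u v) = head u * head v.
Proof. by rewrite /head monoM; congr mono; apply/ffunP => i; rewrite !ffunE. Qed.

Let tailM (u v : mword n p.+1) : tail (mmul u v) = tail u * tail v.
Proof. by rewrite /tail monoM; congr mono; apply/ffunP => i; rewrite !ffunE. Qed.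

Let lr_comm (x : tens V 2) (y : tens V p) :
  lplace p x * rplace p y =
  rplace p y * lplace p x.
Proof. by apply: brk0_comm; apply: place_disjoint => a b; exact: negbT (eq_lrshift a b). Qed.

Let mulACA (x x' : tens V 2) (y y' : tens V p) :
  lplace p (x * x') * rplace p (y * y') =
  (lplace p x * rplace p y) *
  (lplace p x' * rplace p y').
Proof.
rewrite (placeM _ x) (placeM _ y); apply: mulr_interchange; exact: lr_comm.
Qed.

(** The image of the first factor and the later factors occupy disjoint legs, hence commute, and the
    product can be regrouped factor by factor. *)
Lemma tens_id_morph (x y : tens V p.+1) :
  tens_id D (x * y) = tens_id D x * tens_id D y.
Proof.
pose F (x y : tens V p.+1) : tens V p.+2 := tens_id D (x * y).
pose G (x y : tens V p.+1) : tens V p.+2 := tens_id D x * tens_id D y.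
suff : F =2 G by apply.
apply: bilinear_eq; rewrite /F /G.
- by move=> b c x1 x2; rewrite mulr_linearl tens_idP.
- by move=> b c x1 x2; rewrite mulr_linearr tens_idP.
- by move=> b c x1 x2; rewrite tens_idP mulr_linearl.
- by move=> b c x1 x2; rewrite tens_idP mulr_linearr.
move=> u v; rewrite monoM !tens_id_mono -!/(head _) -!/(tail _).
by rewrite headM tailM DM; apply: mulACA.
Qed.

Lemma tens_id_derivation (x y : tens V p.+1) :
  tens_id d (x * y) = tens_id D x * tens_id d y + tens_id d x * tens_id D y.
Proof.
pose F (x y : tens V p.+1) : tens V p.+2 := tens_id d (x * y).
pose G (x y : tens V p.+1) : tens V p.+2 := tens_id D x * tens_id d y + tens_id d x * tens_id D y.
suff : F =2 G by apply.
apply: bilinear_eq; rewrite /F /G.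
- by move=> b c x1 x2; rewrite mulr_linearl tens_idP.
- by move=> b c x1 x2; rewrite mulr_linearr tens_idP.
- by move=> b c x1 x2; rewrite (tens_idP d) (tens_idP D) mulr_linearl2.
- by move=> b c x1 x2; rewrite (tens_idP d) (tens_idP D) mulr_linearr2.
move=> u v; rewrite monoM !tens_id_mono -!/(head _) -!/(tail _).
have Dd := mulACA (D (head u)) (d (head v)) (tail u) (tail v).
have dD := mulACA (d (head u)) (D (head v)) (tail u) (tail v).
rewrite headM tailM dM placeD tens_mulDl; apply: (f_equal2 _ Dd dD).
Qed.

Lemma tens_id_brk (x y : tens V p.+1) :
  tens_id d (brk x y) = brk (tens_id D x) (tens_id d y) - brk (tens_id D y) (tens_id d x).
Proof.
rewrite /brk linearB /= !tens_id_derivation; exact: derivation_commutator.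
Qed.

End Derivation.

End TensId.

(** * The coproduct and the cobracket *)

Section Coproduct.
Variables (k : fieldType) (V : vectType k).
Local Notation n := (\dim {:V}).
Local Notation T := (tens V 1).

Definition letter (i : 'I_n) : T := mono [ffun=> [:: i]].

Definition coprod_word (w : seq 'I_n) : tens V 2 :=
  foldr (fun i t => diag 2 (letter i) * t) 1 w.

Definition coprod : T -> tens V 2 := lin_ext (fun w => coprod_word (w ord0)).

HB.instance Definition _ := GRing.Linear.copy coprod (lin_ext _).

Lemma coprod_mono (w : mword n 1) : coprod (mono w) = coprod_word (w ord0).
Proof. exact: lin_ext_mono. Qed.

Lemma coprodP c (x y : T) : coprod (c *: x + y) = c *: coprod x + coprod y.
Proof. exact: linearP. Qed.

Lemma coprod_word_cat u v : coprod_word (u ++ v) = coprod_word u * coprod_word v.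
Proof.
elim: u => [|i u IH] /=; first by rewrite mul1r.
by rewrite IH; apply: mulrA.
Qed.

Lemma coprodM (x y : T) : coprod (x * y) = coprod x * coprod y.
Proof.
pose F (x y : T) : tens V 2 := coprod (x * y).
pose G (x y : T) : tens V 2 := coprod x * coprod y.
suff : F =2 G by apply.
apply: bilinear_eq; rewrite /F /G.
- by move=> b c x1 x2; rewrite mulr_linearl coprodP.
- by move=> b c x1 x2; rewrite mulr_linearr coprodP.
- by move=> b c x1 x2; rewrite coprodP mulr_linearl.
- by move=> b c x1 x2; rewrite coprodP mulr_linearr.
by move=> u v; rewrite monoM !coprod_mono ffunE coprod_word_cat.
Qed.

Lemma coprod1 : coprod 1 = 1.
Proof. by rewrite -mono1 coprod_mono ffunE. Qed.

Lemma coprod_letter i : coprod (letter i) = diag 2 (letter i).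
Proof. by rewrite coprod_mono ffunE /= mulr1. Qed.

Lemma inclE (v : V) : incl v = \sum_(i < n) coord (vbasis {:V}) i v *: letter i.
Proof. by []. Qed.

Lemma coprod_incl v : coprod (incl v) = diag 2 (incl v).
Proof.
rewrite inclE !linear_sum; apply: eq_bigr => i _.
by rewrite !linearZ /= coprod_letter.
Qed.

Lemma coprod_brk (x y : T) : coprod (brk x y) = brk (coprod x) (coprod y).
Proof. by rewrite /brk linearB /= (coprodM x) (coprodM y). Qed.

Lemma free_lie_is_lie : lie_subalgebra (@free_lie k V).
Proof.
split=> [g [] //|x y Lx Ly g gL gV|c x Lx g gL gV|x y Lx Ly g gL gV].
- by case: (gL) => _ gD _ _; apply: gD; [apply: Lx | apply: Ly].
- by case: (gL) => _ _ gZ _; apply: gZ; apply: Lx.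
- by case: (gL) => _ _ _ gB; apply: gB; [apply: Lx | apply: Ly].
Qed.

Lemma free_lie_incl v : free_lie (incl v : T).
Proof. by move=> g _; apply. Qed.

Lemma in_V_free_lie (x : T) : in_V x -> free_lie x.
Proof. by move=> [v ->]; apply: free_lie_incl. Qed.

(** The impredicative definition is applied to the conjunction of [free_lie] and [P], so that the
    bracket case also knows that its arguments are Lie elements. *)
Lemma free_lie_ind (P : T -> Prop) :
  P 0 -> (forall x y, P x -> P y -> P (x + y)) -> (forall c x, P x -> P (c *: x)) ->
  (forall v, P (incl v)) ->
  (forall x y, free_lie x -> free_lie y -> P x -> P y -> P (brk x y)) ->
  forall x, free_lie x -> P x.
Proof.
move=> P0 PD PZ PV PB x Lx; have [L0 LD LZ LB] := free_lie_is_lie.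
suff [] : free_lie x /\ P x by [].
apply: (Lx (fun x => free_lie x /\ P x)) => [|v]; last first.
  by split; [apply: free_lie_incl | apply: PV].
split=> [|y z [Ly Py] [Lz Pz]|c y [Ly Py]|y z [Ly Py] [Lz Pz]]; split=> //.
- exact: LD.
- exact: PD.
- exact: LZ.
- exact: PZ.
- exact: LB.
- exact: PB.
Qed.

(** Lie elements are primitive: this converts the derivation rule along [coprod] into the cocycle
    rule along [diag 2]. *)
Lemma coprod_free_lie (x : T) : free_lie x -> coprod x = diag 2 x.
Proof.
elim/free_lie_ind=> [|x1 x2 IH1 IH2|c x1 IH1|v|x1 x2 _ _ IH1 IH2].
- by rewrite !linear0.
- by rewrite !linearD /= IH1 IH2.
- by rewrite !linearZ /= IH1.
- exact: coprod_incl.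
- by rewrite coprod_brk brk_diag IH1 IH2.
Qed.

Section Cobracket.
Variable s : tens V 2.

Definition cobr_gen (x : T) : tens V 2 := brk s (leg 0 x) - brk (flip s) (leg 1 x).

Fixpoint cobr_word (w : seq 'I_n) : tens V 2 :=
  if w is i :: w' then
    diag 2 (letter i) * cobr_word w' + cobr_gen (letter i) * coprod_word w'
  else 0.

Definition cobr : T -> tens V 2 := lin_ext (fun w => cobr_word (w ord0)).

HB.instance Definition _ := GRing.Linear.copy cobr (lin_ext _).

Lemma cobr_mono (w : mword n 1) : cobr (mono w) = cobr_word (w ord0).
Proof. exact: lin_ext_mono. Qed.

Lemma cobrP c (x y : T) : cobr (c *: x + y) = c *: cobr x + cobr y.
Proof. exact: linearP. Qed.

Lemma cobr_word_cat u v : cobr_word (u ++ v) =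
  coprod_word u * cobr_word v + cobr_word u * coprod_word v.
Proof.
elim: u => [|i u IH] /=; first by rewrite mul1r mul0r addr0.
by rewrite IH coprod_word_cat; apply: derivation_assoc.
Qed.

Lemma cobrM (x y : T) : cobr (x * y) = coprod x * cobr y + cobr x * coprod y.
Proof.
pose F (x y : T) : tens V 2 := cobr (x * y).
pose G (x y : T) : tens V 2 := coprod x * cobr y + cobr x * coprod y.
suff : F =2 G by apply.
apply: bilinear_eq; rewrite /F /G.
- by move=> b c x1 x2; rewrite mulr_linearl cobrP.
- by move=> b c x1 x2; rewrite mulr_linearr cobrP.
- by move=> b c x1 x2; rewrite coprodP cobrP mulr_linearl2.
- by move=> b c x1 x2; rewrite coprodP cobrP mulr_linearr2.
by move=> u v; rewrite monoM !cobr_mono !coprod_mono ffunE cobr_word_cat.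
Qed.

Lemma cobr1 : cobr 1 = 0.
Proof. by rewrite -mono1 cobr_mono ffunE. Qed.

Fact cobr_gen_is_linear : linear cobr_gen.
Proof.
move=> c x y; rewrite /cobr_gen !legP (brkP _ s) (brkP _ (flip s)).
exact: scale_sub_interchange.
Qed.

HB.instance Definition _ := GRing.isLinear.Build k T (tens V 2) _ cobr_gen
  cobr_gen_is_linear.

Lemma cobr_letter i : cobr (letter i) = cobr_gen (letter i).
Proof. by rewrite cobr_mono ffunE /= mulr0 mulr1 add0r. Qed.

Lemma cobr_incl v : cobr (incl v) = cobr_gen (incl v).
Proof.
rewrite inclE !linear_sum; apply: eq_bigr => i _.
by rewrite !linearZ /= cobr_letter.
Qed.

Lemma cobr_brk (x y : T) : free_lie x -> free_lie y ->
  cobr (brk x y) = brk (diag 2 x) (cobr y) - brk (diag 2 y) (cobr x).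
Proof.
move=> /coprod_free_lie <- /coprod_free_lie <-.
rewrite /brk linearB /= (cobrM x) (cobrM y); exact: derivation_commutator.
Qed.

End Cobracket.

End Coproduct.

(** * Tensor powers of a subspace, and antisymmetry *)

Section TensorPower.
Variables (k : fieldType) (V : vectType k).
Local Notation n := (\dim {:V}).
Local Notation T := (tens V 1).
Implicit Types P : T -> Prop.

HB.instance Definition _ := GRing.Linear.copy (@flip k V) (leg2 1 0).

Lemma tensor_power0 P m : tensor_power P (0 : tens V m).
Proof. by exists 0%N, (fun _ _ => 0); split=> [[]|] //; rewrite big_ord0. Qed.

Lemma tensor_powerD P m (x y : tens V m) :
  tensor_power P x -> tensor_power P y -> tensor_power P (x + y).
Proof.
move=> [N [a [Pa ->]]] [N' [a' [Pa' ->]]].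
exists (N + N')%N, (fun j => match split j with inl i => a i | inr i => a' i end).
split=> [j i|]; first by case: split.
rewrite big_split_ord; apply: f_equal2; apply: eq_bigr => j _.
  by rewrite -[lshift _ _]/(unsplit (inl j)) unsplitK.
by rewrite -[rshift _ _]/(unsplit (inr j)) unsplitK.
Qed.

(** The scalar is absorbed into the first factor of each pure tensor, hence the positive degree. *)
Lemma tensor_powerZ P m c (x : tens V m.+1) :
  (forall y, P y -> P (c *: y)) -> tensor_power P x -> tensor_power P (c *: x).
Proof.
move=> PZ [N [a [Pa ->]]].
exists N, (fun j i => if i == ord0 then c *: a j i else a j i); split=> [j i|].
  by case: ifP => _ //; apply: PZ.
rewrite scaler_sumr; apply: eq_bigr => j _; rewrite !pureS.
have -> : leg ord0 (if ord0 == ord0 :> 'I_m.+1 then c *: a j ord0 else a j ord0)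
          = c *: leg ord0 (a j ord0) :> tens V m.+1 by exact: linearZ.
exact: scalerAl.
Qed.

Lemma tensor_powerS P P' m (x : tens V m) :
  (forall y, P y -> P' y) -> tensor_power P x -> tensor_power P' x.
Proof. by move=> PP' [N [a [Pa ->]]]; exists N, a; split=> // j i; apply: PP'. Qed.

Lemma tensor_power_pure P m (a : 'I_m -> T) :
  (forall i, P (a i)) -> tensor_power P (pure a).
Proof. by move=> Pa; exists 1%N, (fun=> a); rewrite big_ord1. Qed.

Lemma pure2 (a : 'I_2 -> T) : pure a = leg 0 (a 0) * leg 1 (a 1).
Proof. exact: prod_ord2. Qed.

Lemma pure3 (a : 'I_3 -> T) : pure a = leg 0 (a 0) * leg 1 (a 1) * leg 2 (a 2).
Proof. exact: prod_ord3. Qed.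

Lemma diag2E (x : T) : diag 2 x = leg 0 x + leg 1 x.
Proof. exact: sum_ord2. Qed.

Lemma diag3E (x : T) : diag 3 x = leg 0 x + leg 1 x + leg 2 x.
Proof. exact: sum_ord3. Qed.

Lemma tensor_power_leg2 P (a b : T) :
  P a -> P b -> tensor_power P (leg 0 a * leg 1 b : tens V 2).
Proof.
move=> Pa Pb; have := @tensor_power_pure P 2 (fun i => if i == 0 then a else b).
by rewrite pure2; apply=> i; case: ifP.
Qed.

Lemma tensor_power_leg3 P (a b c : T) : P a -> P b -> P c ->
  tensor_power P (leg 0 a * leg 1 b * leg 2 c : tens V 3).
Proof.
move=> Pa Pb Pc.
have := @tensor_power_pure P 3 (fun i => if i == 0 then a else if i == 1 then b else c).
by rewrite pure3; apply=> i; do 2?case: ifP.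
Qed.

Lemma tensor_power2_ind P (Q : tens V 2 -> Prop) :
  Q 0 -> (forall x y, Q x -> Q y -> Q (x + y)) ->
  (forall a b, P a -> P b -> Q (leg 0 a * leg 1 b)) ->
  forall t, tensor_power P t -> Q t.
Proof.
move=> Q0 QD Qp t [N [a [Pa ->]]]; apply: big_ind => // j _.
by rewrite pure2; apply: Qp.
Qed.

Lemma brk_pair_leg m (i j : 'I_m) (a b x : T) : i != j ->
  brk (leg i a * leg j b) (leg i x) = leg i (brk a x) * leg j b.
Proof.
move=> neq_ij; rewrite leg_brk; apply: commutator_prodr.
by apply: brk_leg; rewrite eq_sym.
Qed.

Lemma brk_diag_pair (x a b : T) :
  brk (diag 2 x) (leg 0 a * leg 1 b) =
  leg 0 (brk x a) * leg 1 b + leg 0 a * leg 1 (brk x b).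
Proof. by apply: commutator_prod_eq; apply: brk_diag_leg. Qed.

Lemma leg_comm m (i j : 'I_m) (x y : T) : i != j -> leg i x * leg j y = leg j y * leg i x.
Proof. by move=> neq_ij; apply: brk0_comm; apply: brk_leg. Qed.

Lemma leg2_leg0 m (i j : 'I_m) (x : T) : i != j -> leg2 i j (leg 0 x) = leg i x.
Proof. exact: (leg2_leg 0). Qed.

Lemma leg2_leg1 m (i j : 'I_m) (x : T) : i != j -> leg2 i j (leg 1 x) = leg j x.
Proof. exact: (leg2_leg 1). Qed.

Lemma leg2M m (i j : 'I_m) (t u : tens V 2) :
  leg2 i j (t * u) = leg2 i j t * leg2 i j u.
Proof. exact: placeM. Qed.

Lemma leg2_pair m (i j : 'I_m) (a b : T) : i != j ->
  leg2 i j (leg 0 a * leg 1 b) = leg i a * leg j b.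
Proof.
move=> neq_ij; apply: etrans; first exact: leg2M.
by apply: f_equal2; [apply: leg2_leg0 | apply: leg2_leg1].
Qed.

Lemma flip_pair (a b : T) : flip (leg 0 a * leg 1 b : tens V 2) = leg 0 b * leg 1 a.
Proof. by apply: etrans; [apply: leg2_pair | apply: leg_comm]. Qed.

Lemma flipK (t : tens V 2) : flip (flip t) = t.
Proof. by rewrite {1}/flip leg2_flip // leg2_id. Qed.

Lemma flip_brk (t u : tens V 2) : flip (brk t u) = brk (flip t) (flip u).
Proof. exact: place_brk. Qed.

Lemma flip_leg (a : 'I_2) (x : T) : flip (leg a x) = leg (if a == 0 then 1 else 0) x.
Proof. exact: leg2_leg. Qed.

Lemma flip_diag (x : T) : flip (diag 2 x) = diag 2 x.
Proof.
have e10 : (1 : 'I_2) != 0 by [].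
rewrite diag2E /flip /leg2 placeD; apply: etrans; last exact: addrC.
by apply: f_equal2; [apply: (leg2_leg0 x e10) | apply: (leg2_leg1 x e10)].
Qed.

Lemma tensor_power_flip P (t : tens V 2) : tensor_power P t -> tensor_power P (flip t).
Proof.
elim/tensor_power2_ind=> [|x y Px Py|a b Pa Pb].
- by rewrite linear0; apply: tensor_power0.
- by rewrite linearD; apply: tensor_powerD.
- by rewrite flip_pair; apply: tensor_power_leg2.
Qed.

Lemma tensor_power_brk_diag (x : T) (t : tens V 2) : free_lie x ->
  tensor_power (@free_lie k V) t -> tensor_power (@free_lie k V) (brk (diag 2 x) t).
Proof.
move=> Lx; have [_ _ _ LB] := @free_lie_is_lie k V.
elim/tensor_power2_ind=> [|u v Pu Pv|a b La Lb].
- by rewrite brk0r; apply: tensor_power0.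
- by rewrite brkDr; apply: tensor_powerD.
- rewrite brk_diag_pair; apply: tensor_powerD; apply: tensor_power_leg2 => //;
  exact: LB.
Qed.

(** Transpositions generate the symmetric group and the sign is multiplicative. *)
Lemma antisymmetric_tperm m (t : tens V m) :
  (forall i j : 'I_m, i != j -> place (tperm i j) t = - t) -> Defs.antisymmetric t.
Proof.
move=> anti p; have [ts -> dts] := prod_tpermP p.
elim: ts dts => [_|[i j] ts IH /= /andP[/= neq_ij dts]].
  rewrite big_nil odd_perm1 expr0 scale1r place_id // => i.
  by rewrite perm1.
rewrite big_cons odd_permM odd_tperm neq_ij signr_addb /= expr1 mulN1r scaleNr.
rewrite -(IH dts) -placeN -(anti i j neq_ij) place_comp; last exact: perm_inj.
by apply: eq_place => a; rewrite permM.
Qed.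

Lemma antisymmetric_flip (t : tens V 2) : flip t = - t -> Defs.antisymmetric t.
Proof.
move=> tN; apply: antisymmetric_tperm => i j neq_ij; rewrite -tN.
apply: eq_place => a; case: tpermP => [->|->|/eqP ai /eqP aj].
- by case: i j neq_ij => [[|[|?]] ?] [[|[|?]] ?] //= *; apply/val_inj.
- by case: i j neq_ij => [[|[|?]] ?] [[|[|?]] ?] //= *; apply/val_inj.
- by case: i j a neq_ij ai aj => [[|[|?]] ?] [[|[|?]] ?] [[|[|?]] ?].
Qed.

Lemma antisymmetric_leg2 m (i j : 'I_m) (t : tens V 2) : i != j ->
  Defs.antisymmetric t -> leg2 j i t = - leg2 i j t.
Proof.
move=> neq_ij anti; have flipN : flip t = - t.
  have := anti (tperm 0 1); rewrite odd_tperm /= expr1 scaleN1r => <-.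
  apply: eq_place => a; case: tpermP => [->|->|/eqP ai /eqP aj] //.
  by case: a ai aj => [[|[|?]] ?].
by rewrite -leg2_flip // flipN /leg2 placeN.
Qed.

(** The flip exchanges [s] with [flip s] and leg 0 with leg 1, hence the two brackets with each
    other. *)
Lemma flip_cobr_gen (s : tens V 2) (x : T) :
  flip (cobr_gen s x) = - cobr_gen s x.
Proof.
rewrite /cobr_gen; apply: etrans; first exact: placeB.
apply: etrans; last exact: esym (opprB _ _).
apply: f_equal2; last apply: f_equal; (apply: etrans; first exact: flip_brk).
  by apply: f_equal2; rewrite ?flip_leg.
by apply: f_equal2; [exact: flipK | exact: flip_leg].
Qed.

Lemma cobr_exterior (s : tens V 2) (x : T) : tensor_power (@in_V k V) s ->
  free_lie x -> exterior_power (@free_lie k V) (cobr s x).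
Proof.
move=> sV Lx; have [L0 LD LZ LB] := @free_lie_is_lie k V.
suff [Px /antisymmetric_flip ?] :
  tensor_power (@free_lie k V) (cobr s x) /\ flip (cobr s x) = - cobr s x by [].
elim/free_lie_ind: x / Lx => [|x y [Px Nx] [Py Ny]|c x [Px Nx]|v|x y Lx Ly [Px Nx] [Py Ny]].
- by rewrite !linear0; split=> //; apply: tensor_power0.
- rewrite linearD; split; first exact: tensor_powerD.
  rewrite linearD /= Nx Ny; exact: esym (opprD _ _).
- rewrite linearZ; split; first by apply: tensor_powerZ => // ?; apply: LZ.
  by rewrite linearZ /= Nx; apply: scalerN.
- rewrite cobr_incl; split; last exact: flip_cobr_gen.
  (* On a pure tensor the bracket is [[a, v] (x) b], with both factors in L(V). *)
  have legV (t : tens V 2) : tensor_power (@in_V k V) t ->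
      tensor_power (@free_lie k V) (brk t (leg 0 (incl v))).
    elim/tensor_power2_ind=> [|u w Pu Pw|a b /in_V_free_lie La /in_V_free_lie Lb].
    - by rewrite brk0l; apply: tensor_power0.
    - by rewrite brkDl; apply: tensor_powerD.
    - rewrite brk_pair_leg //; apply: tensor_power_leg2 Lb; apply: LB La _.
      exact (free_lie_incl v).
  rewrite /cobr_gen -scaleN1r; apply: tensor_powerD; first exact: legV.
  apply: tensor_powerZ => [y|]; first exact: LZ.
  (* Being the flip of the first bracket, the second one needs no separate computation. *)
  have -> : brk (flip s) (leg 1 (incl v)) = flip (brk s (leg 0 (incl v))).
    by apply: esym; apply: etrans; [exact: flip_brk | rewrite flip_leg].
  by apply: tensor_power_flip; apply: legV.
- rewrite cobr_brk //; split.
    rewrite -scaleN1r; apply: tensor_powerD; first exact: tensor_power_brk_diag.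
    apply: tensor_powerZ => [z|]; first exact: LZ.
    exact: tensor_power_brk_diag.
  have flip_brk_diag (z : T) (t : tens V 2) : flip t = - t ->
      flip (brk (diag 2 z) t) = - brk (diag 2 z) t.
    move=> Nt; apply: etrans; first exact: flip_brk.
    by rewrite flip_diag Nt; apply: brkNr.
  apply: etrans; first exact: placeB.
  apply: etrans; last exact: esym (opprD _ _).
  apply: f_equal2; first exact: flip_brk_diag.
  by apply: f_equal; apply: flip_brk_diag.
Qed.

End TensorPower.

(** * The defect of co-Jacobi *)

Section Evaluation.
Variables (k : fieldType) (V : vectType k).
Local Notation n := (\dim {:V}).
Local Notation T := (tens V 1).
Local Notation L := (@free_lie k V).

HB.instance Definition _ m (x : tens V m) :=
  GRing.isLinear.Build k (tens V m) (tens V m) _ (brk x) (fun c y z => brkP c x y z).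

Lemma tensor_power2_eq P m (f g : {linear tens V 2 -> tens V m}) :
  (forall a b, P a -> P b -> f (leg 0 a * leg 1 b) = g (leg 0 a * leg 1 b)) ->
  forall t, tensor_power P t -> f t = g t.
Proof.
move=> fg t [N [a [Pa ->]]]; rewrite !linear_sum; apply: eq_bigr => j _.
by rewrite pure2; apply: fg.
Qed.

Lemma coprod_lift p (t : tens V p) :
  tens_id (@coprod k V) (place (lift ord0) t) = @place k V p p.+2 (@rshift 2 p) t.
Proof. by rewrite tens_id_lift /= coprod1 place1 mul1r. Qed.

Lemma cobr_lift p (s : tens V 2) (t : tens V p) :
  tens_id (cobr s) (place (lift ord0) t) = 0.
Proof. by rewrite tens_id_lift /= cobr1 place0 mul0r. Qed.

Section Legs.
(** The positions come with equations because the shifted ordinals agree with the numerals of ['I_3]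
    and ['I_4] only up to their bound proofs. The section is used with [p = 1] for the defect of
    co-Jacobi and with [p = 2] for the condition on [phi_s]. *)
Variables (p : nat) (i : 'I_p) (i1 : 'I_p.+1) (j0 j1 j2 : 'I_p.+2).
Hypotheses (i1E : lift ord0 i = i1)
  (j0E : @lshift 2 p 0 = j0 :> 'I_p.+2) (j1E : @lshift 2 p 1 = j1 :> 'I_p.+2)
  (j2E : @rshift 2 p i = j2 :> 'I_p.+2).

Let neq_0i : ord0 != i1. Proof. by rewrite -i1E neq_lift. Qed.
Let neq_j01 : j0 != j1.
Proof. by rewrite -j0E -j1E -val_eqE. Qed.
Let neq_j02 : j0 != j2. Proof. by rewrite -j0E -j2E -val_eqE. Qed.
Let neq_j12 : j1 != j2. Proof. by rewrite -j1E -j2E -val_eqE. Qed.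

Local Notation lplace := (@place k V 2 p.+2 (@lshift 2 p)).
Local Notation rplace := (@place k V p p.+2 (@rshift 2 p)).

Lemma lplace_leg0 (x : T) : lplace (leg 0 x) = leg j0 x.
Proof. by rewrite -j0E; apply: place_leg; apply: lshift_inj. Qed.

Lemma lplace_leg1 (x : T) : lplace (leg 1 x) = leg j1 x.
Proof. by rewrite -j1E; apply: place_leg; apply: lshift_inj. Qed.

Lemma lplace_leg2 (t : tens V 2) : lplace t = leg2 j0 j1 t.
Proof.
rewrite -[in LHS](leg2_id t) -j0E -j1E; apply: place_leg2; exact: lshift_inj.
Qed.

Lemma lplace_flip (t : tens V 2) : lplace (flip t) = leg2 j1 j0 t.
Proof. by rewrite -j0E -j1E; apply: place_leg2; exact: lshift_inj. Qed.

Lemma leg_i1E (x : T) : leg i1 x = place (lift ord0) (leg i x).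
Proof. by rewrite -i1E; apply: esym; apply: place_leg; apply: lift_inj. Qed.

Lemma rplace_leg (x : T) : rplace (leg i x) = leg j2 x.
Proof. by rewrite -j2E; apply: place_leg; exact: (@rshift_inj 2 p). Qed.

Lemma coprod_leg0 (x : T) : L x ->
  tens_id (@coprod k V) (leg ord0 x) = leg j0 x + leg j1 x.
Proof.
move=> Lx; apply: etrans; first exact: tens_id_leg0.
rewrite /= (coprod_free_lie Lx) diag2E placeD.
by apply: f_equal2; [apply: lplace_leg0 | apply: lplace_leg1].
Qed.

Lemma coprod_leg_lift (x : T) : tens_id (@coprod k V) (leg i1 x) = leg j2 x.
Proof.
by rewrite leg_i1E coprod_lift; apply: rplace_leg.
Qed.

Lemma coprod_pair (a b : T) : L a ->
  tens_id (@coprod k V) (leg ord0 a * leg i1 b)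
  = leg j0 a * leg j2 b + leg j1 a * leg j2 b.
Proof.
move=> La; apply: etrans; first exact: (tens_id_morph (@coprodM k V)).
apply: etrans; last exact: tens_mulDl.
by apply: f_equal2; [apply: coprod_leg0 | apply: coprod_leg_lift].
Qed.

Lemma coprod_leg2 (t : tens V 2) : tensor_power L t ->
  tens_id (@coprod k V) (leg2 ord0 i1 t) = leg2 j0 j2 t + leg2 j1 j2 t.
Proof.
pose f : {linear tens V 2 -> tens V p.+2} := tens_id (@coprod k V) \o leg2 ord0 i1.
pose g : {linear tens V 2 -> tens V p.+2} := leg2 j0 j2 \+ leg2 j1 j2.
apply: (@tensor_power2_eq L _ f g) => a b La Lb; rewrite /f /g /=.
rewrite (leg2_pair _ _ neq_0i); apply: etrans; first exact: coprod_pair.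
by apply: f_equal2; apply: esym; apply: leg2_pair.
Qed.

Variable s : tens V 2.

Lemma cobr_leg0 (x : T) : in_V x ->
  tens_id (cobr s) (leg ord0 x) =
  brk (leg2 j0 j1 s) (leg j0 x) - brk (leg2 j1 j0 s) (leg j1 x).
Proof.
move=> [v ->]; rewrite tens_id_leg0 /= cobr_incl.
apply: etrans; first exact: placeB.
apply: f_equal2; last apply: f_equal; (apply: etrans; first exact: place_brk).
  by apply: f_equal2; [apply: lplace_leg2 | apply: lplace_leg0].
by apply: f_equal2; [apply: lplace_flip | apply: lplace_leg1].
Qed.

Lemma cobr_leg_lift (x : T) : tens_id (cobr s) (leg i1 x) = 0.
Proof. by rewrite leg_i1E; apply: cobr_lift. Qed.

(** On a generator [a] the cobracket is a difference of brackets with [s]. These involve only the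
    legs [j0] and [j1], which commute with the leg [j2] of [b], so [b] can be drawn inside. *)
Lemma cobr_pair (a b : T) : in_V a ->
  tens_id (cobr s) (leg ord0 a * leg i1 b) =
    brk (leg2 j0 j1 s) (leg j0 a * leg j2 b)
  - brk (leg2 j1 j0 s) (leg j1 a * leg j2 b).
Proof.
move=> Va; have La := in_V_free_lie Va.
apply: etrans; first exact (@tens_id_derivation _ _ (@coprod k V) (cobr s) p (@cobrM k V s) _ _).
apply: etrans; first exact: (add_mul_eq _ (cobr_leg_lift b) (cobr_leg0 Va) (coprod_leg_lift b)).
apply: commutator_sub_mulr; apply: brk_leg2_leg => //.
Qed.

Lemma cobr_leg2 (t : tens V 2) : tensor_power (@in_V k V) t ->
  tens_id (cobr s) (leg2 ord0 i1 t) =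
    brk (leg2 j0 j1 s) (leg2 j0 j2 t) - brk (leg2 j1 j0 s) (leg2 j1 j2 t).
Proof.
pose f : {linear tens V 2 -> tens V p.+2} := tens_id (cobr s) \o leg2 ord0 i1.
pose g : {linear tens V 2 -> tens V p.+2} :=
  (brk (leg2 j0 j1 s) \o leg2 j0 j2) \- (brk (leg2 j1 j0 s) \o leg2 j1 j2).
apply: (@tensor_power2_eq (@in_V k V) _ f g) => a b Va Vb; rewrite /f /g /=.
rewrite (leg2_pair _ _ neq_0i); apply: etrans; first exact: cobr_pair.
by apply: f_equal2; last apply: f_equal;
  apply: (f_equal (brk _)); apply: esym; apply: leg2_pair.
Qed.

Lemma coprod_leg2_flip (t : tens V 2) : tensor_power L t ->
  tens_id (@coprod k V) (leg2 i1 ord0 t) = leg2 j2 j0 t + leg2 j2 j1 t.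
Proof.
move=> Lt.
apply: (etrans (f_equal (tens_id _) (esym (leg2_flip t neq_0i)))).
apply: etrans; first exact: (coprod_leg2 (tensor_power_flip Lt)).
by apply: f_equal2; apply: leg2_flip.
Qed.

Lemma cobr_leg2_flip (t : tens V 2) : tensor_power (@in_V k V) t ->
  tens_id (cobr s) (leg2 i1 ord0 t) =
    brk (leg2 j0 j1 s) (leg2 j2 j0 t) - brk (leg2 j1 j0 s) (leg2 j2 j1 t).
Proof.
move=> Vt.
apply: (etrans (f_equal (tens_id _) (esym (leg2_flip t neq_0i)))).
apply: etrans; first exact: (cobr_leg2 (tensor_power_flip Vt)).
by apply: f_equal2; last apply: f_equal;
  apply: (f_equal (brk _)); apply: leg2_flip.
Qed.

End Legs.

End Evaluation.

Section Defect.
Variables (k : fieldType) (V : vectType k) (s : tens V 2).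
Hypothesis sV : tensor_power (@in_V k V) s.
Local Notation T := (tens V 1).
Local Notation L := (@free_lie k V).

Local Notation rot c := (fun i : 'I_3 => i + c).

Lemma cp_eq (t t0 t1 t2 : tens V 3) :
  place (rot 0) t = t0 -> place (rot 1) t = t1 -> place (rot 2) t = t2 ->
  cp t = t0 + t1 + t2.
Proof. by move=> <- <- <-; apply: sum_ord3. Qed.

(** Positions are compared through [val], so that for concrete numerals the side conditions hold by
    computation. *)
Lemma leg2_rot c (i j i' j' : 'I_3) (t : tens V 2) :
  val (rot c i) = val i' -> val (rot c j) = val j' ->
  place (rot c) (leg2 i j t) = leg2 i' j' t.
Proof.
move=> /val_inj <- /val_inj <-; exact: (place_leg2 _ _ _ (@addIr _ c)).
Qed.

Lemma leg_rot c (i i' : 'I_3) (x : T) :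
  val (rot c i) = val i' -> place (rot c) (leg i x) = leg i' x.
Proof. move=> /val_inj <-; exact: (place_leg _ _ (@addIr _ c)). Qed.

Local Notation br3 i j l := (brk (leg2 i j s) (leg2 i l s)).

Lemma phi_sE :
  phi_s s = - (br3 (0 : 'I_3) 1 2 + br3 1 2 0 + br3 2 0 1).
Proof.
rewrite /phi_s; apply: f_equal; apply: cp_eq; (apply: etrans; first exact: place_brk);
by apply: f_equal2; apply: leg2_rot.
Qed.

Let cobr2_leg (i j l : 'I_3) (x : T) : tens V 3 :=
  cobr2 (leg2 i j s) (leg2 i l s) (leg2 j i s) (leg2 j l s) (leg2 l i s)
    (leg2 l j s) (leg i x) (leg j x) (leg l x).

Let cobr2_leg_rot c (i j l i' j' l' : 'I_3) (x : T) :
  val (rot c i) = val i' -> val (rot c j) = val j' -> val (rot c l) = val l' ->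
  place (rot c) (cobr2_leg i j l x) = cobr2_leg i' j' l' x.
Proof.
move=> ei ej el; apply: etrans; first exact: cobr2_morph.
by apply: cobr2_congr; (exact: leg2_rot || exact: leg_rot).
Qed.

Lemma cobr_cobr_gen (x : T) : in_V x ->
  tens_id (p := 1) (cobr s) (cobr_gen s x) = cobr2_leg 0 1 2 x.
Proof.
move=> Vx; have Lx := in_V_free_lie Vx.
have Ls := tensor_powerS (@in_V_free_lie k V) sV.
have i1E : lift ord0 (ord0 : 'I_1) = 1 :> 'I_2 by apply/val_inj.
have j0E : @lshift 2 1 0 = 0 :> 'I_3 by apply/val_inj.
have j1E : @lshift 2 1 1 = 1 :> 'I_3 by apply/val_inj.
have j2E : @rshift 2 1 ord0 = 2 :> 'I_3 by apply/val_inj.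
rewrite /cobr_gen linearB /=.
have Ebrk := @tens_id_brk k V (@coprod k V) (cobr s) 1 (@cobrM k V s).
apply: etrans; first exact: (f_equal2 (fun a b => a - b) (Ebrk _ _) (Ebrk _ _)).
apply: cobr2_eq.
- rewrite -[in LHS](leg2_id s); exact: (coprod_leg2 i1E j0E j1E j2E Ls).
- exact: (cobr_leg0 j0E j1E s Vx).
- exact: (coprod_leg0 j0E j1E Lx).
- rewrite -[X in tens_id _ X](leg2_id s); exact: (cobr_leg2 i1E j0E j1E j2E s sV).
- exact: (coprod_leg2_flip i1E j0E j1E j2E Ls).
- exact: (cobr_leg_lift i1E s x).
- exact: (coprod_leg_lift i1E j2E x).
- exact: (cobr_leg2_flip i1E j0E j1E j2E s sV).
Qed.

Lemma defect_gen (x : T) : in_V x ->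
  cp (tens_id (p := 1) (cobr s) (cobr_gen s x)) = brk (diag 3 x) (phi_s s).
Proof.
move=> Vx; rewrite (cobr_cobr_gen Vx) diag3E phi_sE.
apply: etrans; last apply: cobr2_cyclic; try exact: brk_leg2_leg.
by apply: cp_eq; apply: cobr2_leg_rot.
Qed.

End Defect.

Section Linearity.
Variables (k : fieldType) (V : vectType k).

Fact cp_is_linear : linear (@cp k V).
Proof.
move=> c x y; rewrite /cp scaler_sumr -big_split /=.
by apply: eq_bigr => i _; apply: placeP.
Qed.

HB.instance Definition _ :=
  GRing.isLinear.Build k (tens V 3) (tens V 3) _ (@cp k V) cp_is_linear.

Fact Alt_is_linear m : linear (@Alt k V m).
Proof.
move=> c x y; rewrite /Alt scaler_sumr -big_split /=; apply: eq_bigr => p _.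
rewrite placeP; exact: scale_linear.
Qed.

HB.instance Definition _ m :=
  GRing.isLinear.Build k (tens V m) (tens V m) _ (@Alt k V m) (@Alt_is_linear m).

Lemma free_lie_eq m (F G : {linear tens V 1 -> tens V m}) :
  (forall v, F (incl v) = G (incl v)) ->
  (forall x y, free_lie x -> free_lie y -> F x = G x -> F y = G y ->
     F (brk x y) = G (brk x y)) ->
  forall x, free_lie x -> F x = G x.
Proof.
move=> FGV FGB; apply: free_lie_ind => //.
- by rewrite !linear0.
- by move=> x y Fx Fy; rewrite !linearD Fx Fy.
- by move=> c x Fx; rewrite !linearZ Fx.
Qed.

Lemma Alt_place m (p : 'S_m) (t : tens V m) : Alt (place p t) = (-1) ^+ p *: Alt t.
Proof.
(* The product [p^-1 * q] applies [p^-1] first, so this shift cancels the inner [place p] and leaves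
   the sign of [p]. *)
rewrite /Alt scaler_sumr (reindex_inj (mulgI p^-1%g)) /=.
apply: eq_bigr => q _; rewrite scalerA odd_permM odd_permV signr_addb.
rewrite place_comp; last exact: perm_inj.
by apply: f_equal; apply: eq_place => i; rewrite /= permM permK.
Qed.

End Linearity.

(** * Propagation of the defect identity to brackets *)

Section QuasiLie.
Variables (k : fieldType) (V : vectType k) (s : tens V 2).
Hypothesis sV : tensor_power (@in_V k V) s.
Local Notation T := (tens V 1).
Local Notation L := (@free_lie k V).
Local Notation E := (tens_id (p := 1) (cobr s)).
Local Notation P := (tens_id (p := 1) (@coprod k V)).
Local Notation rot c := (fun i : 'I_3 => i + c).

Let term (i j l : 'I_3) (x y : T) (ex ey : tens V 3) : tens V 3 :=
  let X := cobr s x in let Y := cobr s y in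
  bracket_term (diag 3 x) ey (leg2 i l Y) (leg2 j l Y) (leg2 i j X)
    (diag 3 y) ex (leg2 i l X) (leg2 j l X) (leg2 i j Y).

Lemma place_diag_inj m (g : 'I_m -> 'I_m) (x : T) :
  injective g -> place g (diag m x) = diag m x.
Proof.
move=> g_inj; rewrite -[RHS](place_diag (perm g_inj)).
by apply: eq_place => i; rewrite permE.
Qed.

Let term_rot c (i j l i' j' l' : 'I_3) (x y : T) (ex ey : tens V 3) :
  val (rot c i) = val i' -> val (rot c j) = val j' -> val (rot c l) = val l' ->
  place (rot c) (term i j l x y ex ey) =
  term i' j' l' x y (place (rot c) ex) (place (rot c) ey).
Proof.
move=> ei ej el; apply: etrans; first exact: bracket_term_morph.
have diag_rot z : place (rot c) (diag 3 z : tens V 3) = diag 3 z.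
  by apply: place_diag_inj; apply: addIr.
by apply: bracket_term_congr; [exact: diag_rot | exact: leg2_rot | exact: leg2_rot
  | exact: leg2_rot | exact: diag_rot | exact: leg2_rot | exact: leg2_rot | exact: leg2_rot].
Qed.

Lemma cobr_cobr_brk (x y : T) : L x -> L y ->
  E (cobr s (brk x y)) = term 0 1 2 x y (E (cobr s x)) (E (cobr s y)).
Proof.
move=> Lx Ly; rewrite (cobr_brk s Lx Ly) linearB /=.
have [LX _] := cobr_exterior sV Lx; have [LY _] := cobr_exterior sV Ly.
have i1E : lift ord0 (ord0 : 'I_1) = 1 :> 'I_2 by apply/val_inj.
have j0E : @lshift 2 1 0 = 0 :> 'I_3 by apply/val_inj.
have j1E : @lshift 2 1 1 = 1 :> 'I_3 by apply/val_inj.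
have j2E : @rshift 2 1 ord0 = 2 :> 'I_3 by apply/val_inj.
have Ebrk := @tens_id_brk k V (@coprod k V) (cobr s) 1 (@cobrM k V s).
apply: etrans; first exact: (f_equal2 (fun a b => a - b) (Ebrk _ _) (Ebrk _ _)).
have Pdiag z : L z -> P (diag 2 z) = diag 3 z.
  move=> Lz; rewrite diag2E diag3E linearD /=.
  by apply: f_equal2; [apply: (coprod_leg0 j0E j1E) | apply: (coprod_leg_lift i1E j2E)].
(* The summand of [diag 2 z] in the second leg has first factor [1], which the cobracket kills. *)
have Ediag z : E (diag 2 z) = leg2 0 1 (cobr s z).
  rewrite diag2E linearD /= -[RHS]addr0; apply: f_equal2; last exact: (cobr_leg_lift i1E).
  apply: etrans; first exact: tens_id_leg0.
  exact: (lplace_leg2 j0E j1E).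
have Pleg t : tensor_power L t -> P t = leg2 0 2 t + leg2 1 2 t.
  move=> Lt; rewrite -[in LHS](leg2_id t); exact: (coprod_leg2 i1E j0E j1E j2E Lt).
by apply: bracket_term_eq;
  [exact: Pdiag | exact: Pleg | exact: Ediag | exact: Pdiag | exact: Pleg | exact: Ediag].
Qed.

Lemma defect_free_lie (x : T) : L x -> cp (E (cobr s x)) = brk (diag 3 x) (phi_s s).
Proof.
pose F : {linear T -> tens V 3} := (@cp k V) \o E \o cobr s.
(* The declared linear structure of [brk] is in its second argument; exchanging the arguments costs
   the sign. *)
pose G : {linear T -> tens V 3} := -%R \o brk (phi_s s) \o diag 3.
have GE z : G z = brk (diag 3 z) (phi_s s) by exact: esym (brkC _ _).
suff FG : forall x, L x -> F x = G x by move=> Lx; rewrite -GE -FG.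
apply: free_lie_eq => [v|y z Ly Lz Fy Fz]; rewrite GE.
  by rewrite /F /= cobr_incl; apply: (defect_gen sV); exists v.
rewrite /F /= (cobr_cobr_brk Ly Lz) (brk_diag 3 y z).
have [_ AY] := cobr_exterior sV Ly; have [_ AZ] := cobr_exterior sV Lz.
have cpE (t : tens V 3) : cp t = place (rot 0) t + place (rot 1) t + place (rot 2) t by exact: sum_ord3.
pose ey (i : 'I_3) : tens V 3 := place (rot i) (E (cobr s y)).
pose ez (i : 'I_3) : tens V 3 := place (rot i) (E (cobr s z)).
have ey_sum : ey 0 + ey 1 + ey 2 = brk (diag 3 y) (phi_s s).
  exact (etrans (esym (cpE (E (cobr s y)))) (etrans Fy (GE y))).
have ez_sum : ez 0 + ez 1 + ez 2 = brk (diag 3 z) (phi_s s).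
  exact (etrans (esym (cpE (E (cobr s z)))) (etrans Fz (GE z))).
have anti (i j : 'I_3) (t : tens V 2) : i != j -> Defs.antisymmetric t ->
    leg2 j i t = - leg2 i j t by exact: antisymmetric_leg2.
(* Antisymmetry writes all legs of both cobrackets through the cyclic pairs 01, 12 and 20, among
   which the mixed terms cancel. *)
have sum_terms := defect_bracket (anti 0 1 _ isT AY) (anti 1 2 _ isT AY)
  (anti 2 0 _ isT AY) (anti 0 1 _ isT AZ) (anti 1 2 _ isT AZ) (anti 2 0 _ isT AZ)
  ey_sum ez_sum.
apply: etrans; last exact: sum_terms.
by apply: cp_eq; exact: term_rot.
Qed.

End QuasiLie.

(** * The 3-tensor phi_s *)

Section Phi.
Variables (k : fieldType) (V : vectType k) (s : tens V 2).
Hypothesis sV : tensor_power (@in_V k V) s.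
Local Notation T := (tens V 1).
Local Notation L := (@free_lie k V).
Local Notation br3 i j l := (brk (leg2 i j s) (leg2 i l s)).

Lemma brk_leg2_pairs m (i j l : 'I_m) (a b a' b' : T) :
  i != j -> i != l -> j != l ->
  brk (leg i a * leg j b) (leg i a' * leg l b')
  = leg i (brk a a') * leg j b * leg l b'.
Proof.
move=> nij nil njl; rewrite leg_brk; apply: commutator_pair; apply: brk_leg => //.
by rewrite eq_sym.
Qed.

Lemma brk_leg2Dl m (i j i' j' : 'I_m) (t t' u : tens V 2) :
  brk (leg2 i j (t + t')) (leg2 i' j' u) =
  brk (leg2 i j t) (leg2 i' j' u) + brk (leg2 i j t') (leg2 i' j' u).
Proof.
apply: etrans; last exact: brkDl.
by apply: (f_equal (fun x => brk x (leg2 i' j' u))); apply: placeD.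
Qed.

Lemma brk_leg2Dr m (i j i' j' : 'I_m) (t u u' : tens V 2) :
  brk (leg2 i j t) (leg2 i' j' (u + u')) =
  brk (leg2 i j t) (leg2 i' j' u) + brk (leg2 i j t) (leg2 i' j' u').
Proof.
apply: etrans; last exact: brkDr.
by apply: (f_equal (brk _)); apply: placeD.
Qed.

(** Pure tensors are handled by a hypothesis because the three summands of [phi_s] list their legs
    in the orders 012, 120 and 201. *)
Lemma brk_leg2_ind (i j l : 'I_3) (t u : tens V 2) :
  i != j -> i != l -> j != l ->
  (forall a b c, L a -> L b -> L c ->
     tensor_power L (leg i a * leg j b * leg l c : tens V 3)) ->
  tensor_power (@in_V k V) t -> tensor_power (@in_V k V) u ->
  tensor_power L (brk (leg2 i j t) (leg2 i l u)).
Proof.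
move=> nij nil njl Lleg Vt Vu; have [_ _ _ LB] := @free_lie_is_lie k V.
elim/tensor_power2_ind: t / Vt => [|t t' Lt Lt'|a b /in_V_free_lie La /in_V_free_lie Lb].
- by rewrite linear0 brk0l; apply: tensor_power0.
- by rewrite brk_leg2Dl; apply: tensor_powerD.
elim/tensor_power2_ind: u / Vu => [|u u' Lu Lu'|a' b' /in_V_free_lie La' /in_V_free_lie Lb'].
- by rewrite linear0 brk0r; apply: tensor_power0.
- by rewrite brk_leg2Dr; apply: tensor_powerD.
have -> : brk (leg2 i j (leg 0 a * leg 1 b)) (leg2 i l (leg 0 a' * leg 1 b'))
    = leg i (brk a a') * leg j b * leg l b'.
  apply: etrans; last exact: brk_leg2_pairs.
  by apply: f_equal2; apply: leg2_pair.
by apply: Lleg => //; apply: LB.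
Qed.

Lemma tensor_power_leg120 (a b c : T) : L a -> L b -> L c ->
  tensor_power L (leg 1 a * leg 2 b * leg 0 c : tens V 3).
Proof.
move=> La Lb Lc.
refine (eq_ind_r (@tensor_power k V L 3) (tensor_power_leg3 Lc La Lb) _).
by apply: esym; apply: mulr_rotl; apply: leg_comm.
Qed.

Lemma tensor_power_leg201 (a b c : T) : L a -> L b -> L c ->
  tensor_power L (leg 2 a * leg 0 b * leg 1 c : tens V 3).
Proof.
move=> La Lb Lc.
refine (eq_ind_r (@tensor_power k V L 3) (tensor_power_leg3 Lb Lc La) _).
by apply: mulr_rotl; apply: leg_comm.
Qed.

Lemma phi_s_tensor_power : tensor_power L (phi_s s).
Proof.
have [_ _ LZ _] := @free_lie_is_lie k V.
rewrite phi_sE -scaleN1r; apply: tensor_powerZ => [x|]; first exact: LZ.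
apply: tensor_powerD; first apply: tensor_powerD; apply: brk_leg2_ind => //.
- by move=> a b c La Lb Lc; apply: tensor_power_leg3.
- exact: tensor_power_leg120.
- exact: tensor_power_leg201.
Qed.

(** A form of the transposition that computes on concrete positions. *)
Lemma tpermE_if (T' : finType) (i j x : T') :
  tperm i j x = if x == i then j else if x == j then i else x.
Proof. by case: tpermP => [->|->|/eqP/negPf -> /eqP/negPf ->]; rewrite ?eqxx //; case: eqP. Qed.

Lemma place_br3 (p : 'S_3) (i j l i' j' l' : 'I_3) :
  p i = i' -> p j = j' -> p l = l' ->
  place p (br3 i j l) = br3 i' j' l'.
Proof.
move=> <- <- <-; apply: etrans; first exact: place_brk.
by apply: f_equal2; apply: place_leg2; apply: perm_inj.
Qed.

(** A transposition reverses the cyclic order of the three positions. Each of the three brackets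
    thus becomes one of them with its entries exchanged, that is, with the opposite sign. *)
Lemma phi_s_antisymmetric : Defs.antisymmetric (phi_s s).
Proof.
have br3N i j l : br3 i j l = - br3 i l j :> tens V 3 by exact: brkC.
have tpN (p : 'S_3) (i j l i' j' l' : 'I_3) :
    p i = i' -> p j = l' -> p l = j' -> place p (br3 i j l) = - br3 i' j' l'.
  by move=> ei ej el; apply: etrans (br3N _ _ _); apply: place_br3.
apply: antisymmetric_tperm => i j neq_ij.
pose b0 : tens V 3 := br3 0 1 2; pose b1 : tens V 3 := br3 1 2 0.
pose b2 : tens V 3 := br3 2 0 1.
have -> : phi_s s = - (b0 + b1 + b2) by exact: phi_sE.
wlog lt_ij : i j neq_ij / (i < j)%N.
  move=> IH; case: (ltngtP i j) => [||/val_inj e]; first exact: IH.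
    by rewrite tpermC; apply: IH; rewrite eq_sym.
  by rewrite e eqxx in neq_ij.
have placeN3 c0 c1 c2 : place (tperm i j) b0 = - c0 -> place (tperm i j) b1 = - c1 ->
    place (tperm i j) b2 = - c2 -> c0 + c1 + c2 = b0 + b1 + b2 ->
    place (tperm i j) (- (b0 + b1 + b2)) = - - (b0 + b1 + b2).
  move=> e0 e1 e2 ec; exact: (additive_opp_sum3 e0 e1 e2 (etrans ec (esym (opprK _)))).
have {neq_ij}: [|| (i == 0) && (j == 1), (i == 0) && (j == 2) | (i == 1) && (j == 2)].
  by case: i j lt_ij {neq_ij placeN3} => [[|[|[|?]]] ?] [[|[|[|?]]] ?].
have tpermN (a b c a' b' c' : 'I_3) :
    val (tperm i j a) = val a' -> val (tperm i j b) = val c' ->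
    val (tperm i j c) = val b' ->
    place (tperm i j) (br3 a b c) = - br3 a' b' c'.
  by move=> /val_inj ea /val_inj eb /val_inj ec; apply: tpN.
case/or3P => /andP[/eqP ei /eqP ej]; subst i j.
(* A bracket is determined up to sign by its shared leg, which the transposition moves: here [b0]
   and [b1] are exchanged and [b2] is kept, all with a sign. *)
- apply: (placeN3 b1 b0 b2); [apply: tpermN | apply: tpermN | apply: tpermN |];
    [by rewrite tpermE_if .. |].
  exact: (f_equal (fun x => x + b2) (addrC _ _)).
- apply: (placeN3 b2 b1 b0); [apply: tpermN | apply: tpermN | apply: tpermN |];
    [by rewrite tpermE_if .. |].
  exact: (etrans (addrC _ _) (etrans (f_equal (+%R b0) (addrC _ _)) (addrA _ _ _))).
- apply: (placeN3 b0 b2 b1); [apply: tpermN | apply: tpermN | apply: tpermN |];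
    [by rewrite tpermE_if .. |].
  exact: addrAC.
Qed.

End Phi.

(** * The alternating sum of the cobracket of phi_s *)

Section AltPhi.
Variables (k : fieldType) (V : vectType k) (s : tens V 2).
Hypothesis sV : tensor_power (@in_V k V) s.
Local Notation T := (tens V 1).
Local Notation L := (@free_lie k V).

Let t3 (a b c d e f : 'I_4) : tens V 4 :=
  brk (leg2 a b s) (brk (leg2 c d s) (leg2 e f s)).

Let Alt_swap (i j a b c d e f a' b' c' d' e' f' : 'I_4) : i != j ->
  tperm i j a = a' -> tperm i j b = b' -> tperm i j c = c' ->
  tperm i j d = d' -> tperm i j e = e' -> tperm i j f = f' ->
  Alt (t3 a' b' c' d' e' f') = - Alt (t3 a b c d e f).
Proof.
move=> nij <- <- <- <- <- <-.
have pE (x y : 'I_4) : place (tperm i j) (leg2 x y s) =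
    leg2 (tperm i j x) (tperm i j y) s by apply: place_leg2; apply: perm_inj.
have := Alt_place (tperm i j) (t3 a b c d e f).
rewrite odd_tperm nij expr1 scaleN1r => <-; apply: f_equal; apply: esym.
apply: etrans; first exact: place_brk.
apply: f_equal2; first exact: pE.
apply: etrans; first exact: place_brk.
by apply: f_equal2; exact: pE.
Qed.

Hypothesis char0 : [pchar k] =i pred0.

(** A cyclic permutation of the leaves [i], [j], [l] is even, so the three rotated commutators have
    the same alternating sum; by Jacobi these three equal values add up to zero. *)
Let Alt_star (c i j l : 'I_4) :
  c != i -> c != j -> c != l -> i != j -> i != l -> j != l ->
  Alt (t3 c i c j c l) = 0.
Proof.
move=> nci ncj ncl nij nil njl.
have rot (x y z : 'I_4) : c != x -> c != y -> c != z -> x != y -> x != z -> y != z ->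
    Alt (t3 c y c z c x) = Alt (t3 c x c y c z).
  move=> ncx ncy ncz nxy nxz nyz.
  have e1 : Alt (t3 c y c x c z) = - Alt (t3 c x c y c z).
    apply: (@Alt_swap x y) => //; rewrite ?tpermL ?tpermR ?tpermD //; by rewrite eq_sym.
  have e2 : Alt (t3 c y c z c x) = - Alt (t3 c y c x c z).
    apply: (@Alt_swap x z) => //; rewrite ?tpermL ?tpermR ?tpermD //; by rewrite eq_sym.
  exact: etrans e2 (etrans (f_equal -%R e1) (opprK _)).
have e1 := rot i j l nci ncj ncl nij nil njl.
have [nji nli] : j != i /\ l != i by split; rewrite eq_sym.
have e2 := rot j l i ncj ncl nci njl nji nli.
have AltD (x y : tens V 4) : Alt (x + y) = Alt x + Alt y by exact: linearD.
have sum0 : Alt (t3 c i c j c l) + Alt (t3 c j c l c i) + Alt (t3 c l c i c j) = 0.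
  transitivity (Alt (t3 c i c j c l + t3 c j c l c i + t3 c l c i c j)).
    apply: esym; apply: etrans; first exact: AltD.
    exact: (f_equal (fun z => z + _) (AltD _ _)).
  by apply: etrans (linear0 (@Alt k V 4)); apply: f_equal; apply: commutator_cyclicr.
exact: (cyclic_sum_eq0 char0 e1 e2 sum0).
Qed.

Lemma tens_id_cobr_phi :
  let q (i j : 'I_4) := leg2 i j s in
  exists x y : tens V 4, tens_id (p := 2) (cobr s) (phi_s s) =
    - (brk (q 0 2 + q 1 2) (brk (q 0 1) (q 0 3) - brk (q 1 0) (q 1 3))
       - brk (q 0 3 + q 1 3) (brk (q 0 1) (q 0 2) - brk (q 1 0) (q 1 2))
       + (brk (q 2 3) (brk (q 0 1) (q 2 0) - brk (q 1 0) (q 2 1)) - brk x 0)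
       + (brk y 0 - brk (q 3 2) (brk (q 0 1) (q 3 0) - brk (q 1 0) (q 3 1)))).
Proof.
move=> q.
have Ls := tensor_powerS (@in_V_free_lie k V) sV.
have l0 : lift ord0 (0 : 'I_2) = 1 :> 'I_3 by apply/val_inj.
have l1 : lift ord0 (1 : 'I_2) = 2 :> 'I_3 by apply/val_inj.
have j0 : @lshift 2 2 0 = 0 :> 'I_4 by apply/val_inj.
have j1 : @lshift 2 2 1 = 1 :> 'I_4 by apply/val_inj.
have j2 : @rshift 2 2 0 = 2 :> 'I_4 by apply/val_inj.
have j3 : @rshift 2 2 1 = 3 :> 'I_4 by apply/val_inj.
have Ebrk := @tens_id_brk k V (@coprod k V) (cobr s) 2 (@cobrM k V s).
pose E : tens V 3 -> tens V 4 := tens_id (p := 2) (cobr s).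
pose P : tens V 3 -> tens V 4 := tens_id (p := 2) (@coprod k V).
have liftE (a b : 'I_2) (i j : 'I_3) : lift ord0 a = i -> lift ord0 b = j ->
    leg2 i j s = place (lift ord0) (leg2 a b s).
  by move=> <- <-; apply: esym; apply: place_leg2; apply: lift_inj.
have E12 : E (leg2 1 2 s) = 0.
  by apply: etrans (f_equal E (liftE _ _ _ _ l0 l1)) _; apply: cobr_lift.
have E21 : E (leg2 2 1 s) = 0.
  by apply: etrans (f_equal E (liftE _ _ _ _ l1 l0)) _; apply: cobr_lift.
have P12 : P (leg2 1 2 s) = q 2 3.
  apply: etrans (f_equal P (liftE _ _ _ _ l0 l1)) _; apply: etrans; first exact: coprod_lift.
  by rewrite /q -j2 -j3; apply: place_leg2; exact: (@rshift_inj 2 2).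
have P21 : P (leg2 2 1 s) = q 3 2.
  apply: etrans (f_equal P (liftE _ _ _ _ l1 l0)) _; apply: etrans; first exact: coprod_lift.
  by rewrite /q -j2 -j3; apply: place_leg2; exact: (@rshift_inj 2 2).
have brk2 (a b c d a' b' c' d' : tens V 4) : a = a' -> b = b' -> c = c' -> d = d' ->
    brk a b - brk c d = brk a' b' - brk c' d' by move=> -> -> -> ->.
(* These coproducts are bracketed with the cobracket of a tensor in legs 1 and 2 only, which is 0,
   so they can stay unevaluated. *)
exists (P (leg2 1 0 s)), (P (leg2 2 0 s)).
rewrite phi_sE linearN; apply: f_equal; rewrite linearD.
apply: f_equal2; first (rewrite linearD; apply: f_equal2); (apply: etrans; first exact: Ebrk).
- apply: brk2.
  + exact: (coprod_leg2 l0 j0 j1 j2 Ls).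
  + exact: (cobr_leg2 l1 j0 j1 j3 s sV).
  + exact: (coprod_leg2 l1 j0 j1 j3 Ls).
  + exact: (cobr_leg2 l0 j0 j1 j2 s sV).
- apply: brk2.
  + exact: P12.
  + exact: (cobr_leg2_flip l0 j0 j1 j2 s sV).
  + exact: erefl.
  + exact: E12.
- apply: brk2.
  + exact: erefl.
  + exact: E21.
  + exact: P21.
  + exact: (cobr_leg2_flip l1 j0 j1 j3 s sV).
Qed.

Lemma Alt_cobr_phi : Alt (tens_id (p := 2) (cobr s) (phi_s s)) = 0.
Proof.
have [x [y ->]] := tens_id_cobr_phi.
have swap (i j a b c d e f a' b' c' d' e' f' : 'I_4) : i != j ->
    val (tperm i j a) = val a' -> val (tperm i j b) = val b' ->
    val (tperm i j c) = val c' -> val (tperm i j d) = val d' ->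
    val (tperm i j e) = val e' -> val (tperm i j f) = val f' ->
    forall z, Alt (t3 a b c d e f) = z -> Alt (t3 a' b' c' d' e' f') = - z.
  move=> nij /val_inj ea /val_inj eb /val_inj ec /val_inj ed /val_inj ee /val_inj ef z <-.
  exact: (Alt_swap nij).
(* The reference path visits 2, 1, 0, 3. The other path terms are reached from it by transpositions
   of positions, each contributing a sign. *)
pose b := Alt (t3 1 2 0 1 0 3).
have e5 : Alt (t3 1 2 0 1 0 3) = b by [].
have e6 : Alt (t3 0 2 1 0 1 3) = - b.
  by apply: (swap 0 1 _ _ _ _ _ _ _ _ _ _ _ _ isT _ _ _ _ _ _ _ e5); rewrite tpermE_if.
have e7 : Alt (t3 1 3 0 1 0 2) = - b.
  by apply: (swap 2 3 _ _ _ _ _ _ _ _ _ _ _ _ isT _ _ _ _ _ _ _ e5); rewrite tpermE_if.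
have e8 : Alt (t3 0 3 1 0 1 2) = b.
  rewrite -[RHS]opprK.
  by apply: (swap 0 1 _ _ _ _ _ _ _ _ _ _ _ _ isT _ _ _ _ _ _ _ e7); rewrite tpermE_if.
have e9' : Alt (t3 0 1 2 0 2 3) = b.
  rewrite -[RHS]opprK.
  by apply: (swap 1 2 _ _ _ _ _ _ _ _ _ _ _ _ isT _ _ _ _ _ _ _ e6); rewrite tpermE_if.
(* In this term the middle edge [s^{20}] is in the inner bracket with [s^{01}]. The disjoint edges
   [s^{23}] and [s^{01}] commute, so Jacobi makes [s^{01}] the outer entry, which gives the shape of
   the reference path. *)
have e9 : Alt (t3 2 3 0 1 2 0) = - b.
  transitivity (Alt (- t3 0 1 2 0 2 3)).
    by apply: f_equal; apply: commutator_swap; apply: brk_leg2.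
  by apply: etrans; [exact: linearN | apply: f_equal; exact: e9'].
have e10 : Alt (t3 2 3 1 0 2 1) = b.
  rewrite -[RHS]opprK.
  by apply: (swap 0 1 _ _ _ _ _ _ _ _ _ _ _ _ isT _ _ _ _ _ _ _ e9); rewrite tpermE_if.
have e11 : Alt (t3 3 2 0 1 3 0) = b.
  rewrite -[RHS]opprK.
  by apply: (swap 2 3 _ _ _ _ _ _ _ _ _ _ _ _ isT _ _ _ _ _ _ _ e9); rewrite tpermE_if.
have e12 : Alt (t3 3 2 1 0 3 1) = - b.
  by apply: (swap 2 3 _ _ _ _ _ _ _ _ _ _ _ _ isT _ _ _ _ _ _ _ e10); rewrite tpermE_if.
have s1 : Alt (t3 0 2 0 1 0 3) = 0 by apply: Alt_star.
have s2 : Alt (t3 1 2 1 0 1 3) = 0 by apply: Alt_star.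
have s3 : Alt (t3 0 3 0 1 0 2) = 0 by apply: Alt_star.
have s4 : Alt (t3 1 3 1 0 1 2) = 0 by apply: Alt_star.
exact: (alt_defect (f := @Alt k V 4) x y s1 s2 s3 s4 e5 e6 e7 e8 e9 e10 e11 e12).
Qed.

End AltPhi.

(** * Coefficients and rank *)

Section Coefficients.
Variables (k : fieldType) (V : vectType k).
Local Notation n := (\dim {:V}).
Local Notation T := (tens V 1).
Local Notation L := (@free_lie k V).
Local Notation letter := (@letter k V).

Definition word (u : seq 'I_n) : mword n 1 := [ffun=> u].

Lemma mcoeffP m (w : mword n m) c (x y : tens V m) :
  (c *: x + y)@_w = c * x@_w + y@_w.
Proof. by apply: etrans; [apply: mcoeffD | rewrite mcoeffZ]. Qed.

Lemma mcoeff_mono m (u w : mword n m) : (mono u : tens V m)@_w = (u == w)%:R.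
Proof. exact: mcoeffU1. Qed.

Lemma functional_eq m (f g : tens V m -> k) :
  (forall c x y, f (c *: x + y) = c * f x + f y) ->
  (forall c x y, g (c *: x + y) = c * g x + g y) ->
  (forall w, f (mono w) = g (mono w)) -> f =1 g.
Proof.
move=> fP gP fg.
have f0 : f 0 = 0 by have := fP (-1) 0 0; rewrite scaler0 addr0 mulN1r addNr.
have g0 : g 0 = 0 by have := gP (-1) 0 0; rewrite scaler0 addr0 mulN1r addNr.
elim/tens_ind => [|x y fx fy|c x fx|//]; first by rewrite f0 g0.
  by have := fP 1 x y; have := gP 1 x y; rewrite scale1r !mul1r fx fy => -> ->.
by have := fP c x 0; have := gP c x 0; rewrite addr0 f0 g0 !addr0 fx => -> ->.
Qed.

Lemma leg_mono m (i : 'I_m) (u : mword n 1) :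
  leg i (mono u : T) = mono [ffun j => if j == i then u ord0 else [::]].
Proof.
apply: etrans; first exact: place_mono.
congr mono; apply/ffunP => j; rewrite !ffunE.
case: pickP => [a /eqP <-|/(_ ord0)]; first by rewrite eqxx (ord1 a).
by rewrite eq_sym => ->.
Qed.

Lemma mcoeff_legs3 (a b c : T) (w : mword n 3) :
  (leg 0 a * leg 1 b * leg 2 c)@_w =
  a@_(word (w 0)) * b@_(word (w 1)) * c@_(word (w 2)).
Proof.
pose f (a b c : T) : k := (leg 0 a * leg 1 b * leg 2 c : tens V 3)@_w.
pose g (a b c : T) : k := a@_(word (w 0)) * b@_(word (w 1)) * c@_(word (w 2)).
suff fg x y z : f x y z = g x y z by exact: fg.
apply: (@functional_eq _ (fun x => f x y z) (fun x => g x y z)) x => [d x x'|d x x'|u].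
- by rewrite /f legP !mulr_linearl; apply: mcoeffP.
- by rewrite /g mcoeffP !mulrDl !mulrA.
apply: (@functional_eq _ (fun y => f _ y z) (fun y => g _ y z)) y => [d y y'|d y y'|v].
- by rewrite /f legP mulr_linearr mulr_linearl; apply: mcoeffP.
- by rewrite /g mcoeffP mulrDr mulrDl mulrCA !mulrA.
apply: (@functional_eq _ (f _ _) (g _ _)) z => [d z z'|d z z'|t].
- by rewrite /f legP mulr_linearr; apply: mcoeffP.
- by rewrite /g mcoeffP mulrDr mulrCA.
rewrite /f /g !leg_mono !monoM !mcoeff_mono -!natrM !mulnb.
congr (nat_of_bool _)%:R; apply/eqP/andP => [<-|[/andP[/eqP eu /eqP ev] /eqP et]].
  rewrite !ffunE /= !cats0 /=.
  by split; [apply/andP; split|]; apply/eqP/ffunP => i; rewrite ffunE (ord1 i).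
apply/ffunP => i; rewrite eu ev et !ffunE /=.
case: i => [[|[|[|?]]] ?] //=; rewrite ?cats0; congr (w _); exact/val_inj.
Qed.

Lemma mcoeff_monoMl m (u w : mword n m) (x : tens V m) :
  (mono u * x)@_w = \sum_(v <- msupp x) x@_v * (mmul u v == w)%:R.
Proof.
rewrite {1}[x]tens_sum mulr_sumr raddf_sum; apply: eq_bigr => v _.
by rewrite -scalerAr_tens monoM /= mcoeffZ mcoeff_mono.
Qed.

Lemma mcoeff_monoMr m (u w : mword n m) (x : tens V m) :
  (x * mono u)@_w = \sum_(v <- msupp x) x@_v * (mmul v u == w)%:R.
Proof.
rewrite {1}[x]tens_sum mulr_suml raddf_sum; apply: eq_bigr => v _.
by rewrite -scalerAl monoM /= mcoeffZ mcoeff_mono.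
Qed.

Lemma mcoeff_monoMl_eq0 m (u w : mword n m) (x : tens V m) :
  (forall v, mmul u v = w -> x@_v = 0) -> (mono u * x)@_w = 0.
Proof.
move=> x0; rewrite mcoeff_monoMl big1 // => v _.
by case: eqP => [/x0 ->|_]; rewrite ?mul0r ?mulr0.
Qed.

Lemma mcoeff_monoMr_eq0 m (u w : mword n m) (x : tens V m) :
  (forall v, mmul v u = w -> x@_v = 0) -> (x * mono u)@_w = 0.
Proof.
move=> x0; rewrite mcoeff_monoMr big1 // => v _.
by case: eqP => [/x0 ->|_]; rewrite ?mul0r ?mulr0.
Qed.

(** Words cancel on the left, so a single term of the sum contributes. *)
Lemma mcoeff_monoMl_cancel m (u w : mword n m) (x : tens V m) :
  (mono u * x)@_(mmul u w) = x@_w.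
Proof.
have mmulI v : mmul u v = mmul u w -> v = w.
  move=> e; apply/ffunP => i; have := congr1 (fun f : mword n m => f i) e.
  by rewrite !ffunE => /eqP; rewrite eqseq_cat // eqxx /= => /eqP.
rewrite mcoeff_monoMl; case: (boolP (w \in msupp x)) => [w_in|w_notin].
  rewrite (big_rem w) //= eqxx mulr1 big1_seq ?addr0 // => v /andP[_ vx].
  case: eqP => [/mmulI e|_]; last by rewrite mulr0.
  by move: vx; rewrite e mem_rem_uniq ?fset_uniq // inE eqxx.
rewrite (mcoeff_outdom w_notin) big1_seq // => v /andP[_ vx].
by case: eqP => [/mmulI e|_]; [rewrite e (negPf w_notin) in vx | rewrite mulr0].
Qed.

Lemma letterE i : letter i = incl (vbasis {:V})`_i.
Proof.
rewrite inclE (bigD1 i) //= coord_free ?(basis_free (vbasisP _)) // eqxx scale1r.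
rewrite big1 ?addr0 // => j neq_ji.
by rewrite coord_free ?(basis_free (vbasisP _)) // eq_sym (negPf neq_ji) scale0r.
Qed.

Lemma incl_coefs (c : 'I_n -> k) :
  \sum_i c i *: letter i = incl (\sum_i c i *: (vbasis {:V})`_i).
Proof.
apply: eq_bigr => i _; congr (_ *: _).
by rewrite coord_sum_free ?(basis_free (vbasisP _)).
Qed.

Lemma mcoeff_letter i u : (letter i)@_(word u) = ([:: i] == u)%:R.
Proof.
rewrite mcoeff_mono; congr (nat_of_bool _)%:R; apply/eqP/eqP => [|<-] //.
by move=> e; have := congr1 (fun f : mword n 1 => f ord0) e; rewrite !ffunE.
Qed.

Lemma mcoeff_incl v u :
  (incl v)@_(word u) = \sum_i coord (vbasis {:V}) i v * ([:: i] == u)%:R.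
Proof.
by rewrite inclE raddf_sum; apply: eq_bigr => i _; rewrite /= mcoeffZ mcoeff_letter.
Qed.

Lemma in_V_mcoeff (x : T) u : in_V x -> size u != 1%N -> x@_(word u) = 0.
Proof.
move=> [v ->] u1; rewrite mcoeff_incl big1 // => i _.
by case: eqP => [e|_]; [rewrite -e in u1 | rewrite mulr0].
Qed.

Lemma in_V_expand (x : T) : in_V x -> x = \sum_i x@_(word [:: i]) *: letter i.
Proof.
move=> [v ->]; rewrite {1}inclE; apply: eq_bigr => i _; congr (_ *: _).
rewrite mcoeff_incl (bigD1 i) //= eqxx mulr1 big1 ?addr0 // => j neq_ji.
by case: eqP => [[e]|_]; [rewrite e eqxx in neq_ji | rewrite mulr0].
Qed.

(** The constant coefficient is a ring morphism to the commutative ring [k], hence kills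
    brackets. *)
Lemma free_lie_mcoeff1 (x : T) : L x -> x@_(word [::]) = 0.
Proof.
elim/free_lie_ind => [|y z Ly Lz|c y Ly|v|y z _ _ _ _].
- exact: mcoeff0.
- by apply: etrans; [apply: mcoeffD | rewrite Ly Lz addr0].
- by apply: etrans; [apply: mcoeffZ | rewrite Ly mulr0].
- by apply: in_V_mcoeff; first exists v.
have w1 : word [::] = mone by [].
apply: etrans; first exact: mcoeffB.
by rewrite w1 !rmorphM /= mulrC subrr.
Qed.

Lemma tensor_power_mcoeff0 (t : tens V 3) (w : mword n 3) (i : 'I_3) :
  tensor_power L t -> w i = [::] -> t@_w = 0.
Proof.
move=> [N [a [La ->]]] wi; rewrite raddf_sum big1 // => j _ /=.
rewrite pure3 mcoeff_legs3.
have a0 l : w l = [::] -> (a j l)@_(word (w l)) = 0.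
  by move=> ->; apply: free_lie_mcoeff1.
have : [|| i == 0, i == 1 | i == 2] by case: i {wi} => [[|[|[|?]]] ?].
case/or3P => /eqP ei; subst i; rewrite (a0 _ wi); first by rewrite !mul0r.
  by rewrite mulr0 mul0r.
by rewrite mulr0.
Qed.

Definition word3 (a b c : seq 'I_n) : mword n 3 :=
  [ffun i => if i == 0 then a else if i == 1 then b else c].

Lemma word3_inj (w : mword n 3) a b c :
  w = word3 a b c -> [/\ w 0 = a, w 1 = b & w 2 = c].
Proof. by move=> ->; rewrite !ffunE. Qed.

(** The coefficient of [W] is read in the six products of [t] with a leg of the letter [p].
    Multiplying in leg 1 or 2 would need a term of [t] with an empty word there, and tensors over
    L(V) have none. Multiplying on the right in leg 0 would need a word ending in [p], while that of
    [W] ends in [q]. Only left multiplication in leg 0 remains. *)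
Lemma brk_diag_mcoeff (t : tens V 3) (p q r u : 'I_n) :
  p != q -> tensor_power L t -> brk (diag 3 (letter p)) t = 0 ->
  t@_(word3 [:: p; q] [:: r] [:: u]) = 0.
Proof.
move=> neq_pq Lt; pose W := word3 [:: p; p; q] [:: r] [:: u].
pose m (i : 'I_3) : mword n 3 := [ffun j => if j == i then [:: p] else [::]].
have legE i : leg i (letter p) = mono (m i) :> tens V 3.
  apply: etrans; first exact: leg_mono.
  by congr mono; apply/ffunP => j; rewrite !ffunE.
have l0 : (mono (m 0) * t)@_W = t@_(word3 [:: p; q] [:: r] [:: u]).
  have -> : W = mmul (m 0) (word3 [:: p; q] [:: r] [:: u]).
    apply/ffunP => j; rewrite !ffunE; by case: j => [[|[|[|?]]] ?].
  exact: mcoeff_monoMl_cancel.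
have tail0 (a b : 'I_n) (x : seq 'I_n) : [:: a] ++ x = [:: b] -> x = [::].
  by case: x.
have tail0r (a b : 'I_n) (x : seq 'I_n) : x ++ [:: a] = [:: b] -> x = [::].
  by case: x => [|? [|]].
have l1 : (mono (m 1) * t)@_W = 0.
  apply: mcoeff_monoMl_eq0 => v /word3_inj[_ + _]; rewrite ffunE [m 1 1]ffunE.
  by move/tail0; apply: tensor_power_mcoeff0.
have l2 : (mono (m 2) * t)@_W = 0.
  apply: mcoeff_monoMl_eq0 => v /word3_inj[_ _ +]; rewrite ffunE [m 2 2]ffunE.
  by move/tail0; apply: tensor_power_mcoeff0.
have r0 : (t * mono (m 0))@_W = 0.
  apply: mcoeff_monoMr_eq0 => v /word3_inj[+ _ _]; rewrite ffunE [m 0 0]ffunE /=.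
  move/(congr1 (last p)); rewrite last_cat /= => e.
  by rewrite e eqxx in neq_pq.
have r1 : (t * mono (m 1))@_W = 0.
  apply: mcoeff_monoMr_eq0 => v /word3_inj[_ + _]; rewrite ffunE [m 1 1]ffunE.
  by move/tail0r; apply: tensor_power_mcoeff0.
have r2 : (t * mono (m 2))@_W = 0.
  apply: mcoeff_monoMr_eq0 => v /word3_inj[_ _ +]; rewrite ffunE [m 2 2]ffunE.
  by move/tail0r; apply: tensor_power_mcoeff0.
have brkE : brk (diag 3 (letter p)) t =
    mono (m 0) * t + mono (m 1) * t + mono (m 2) * t
    - (t * mono (m 0) + t * mono (m 1) + t * mono (m 2)).
  by rewrite diag3E !legE; apply: commutator_sum3.
move=> brk0; apply: etrans (esym l0) _.
apply: etrans (esym (additive_single (f := mcoeff W) _ l1 l2 r0 r1 r2)) _.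
exact: etrans (f_equal (mcoeff W) (etrans (esym brkE) brk0)) (mcoeff0 W).
Qed.

End Coefficients.

(** * The minors of s and tensors of rank one *)

Section Rank.
Variables (k : fieldType) (V : vectType k).
Local Notation n := (\dim {:V}).
Local Notation T := (tens V 1).
Local Notation L := (@free_lie k V).
Local Notation letter := (@letter k V).

Lemma leg_scale_comm m (i j : 'I_m) c (x y : T) :
  leg i (c *: x) * leg j y = leg i x * leg j (c *: y).
Proof.
have legZ (l : 'I_m) (z : T) : leg l (c *: z) = c *: leg l z by exact: linearZ.
apply: etrans; first exact: (f_equal (fun z => z * _) (legZ i x)).
apply: etrans; last exact: (f_equal (fun z => _ * z) (esym (legZ j y))).
by apply: etrans; [exact: esym (scalerAl _ _ _) | exact: scalerAr_tens].
Qed.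

Lemma in_V0 : in_V (0 : T).
Proof. by exists 0; rewrite inclE big1 // => i _; rewrite linear0 scale0r. Qed.

Lemma in_VP c (x y : T) : in_V x -> in_V y -> in_V (c *: x + y).
Proof.
move=> [v ->] [w ->]; exists (c *: v + w).
rewrite !inclE scaler_sumr -big_split; apply: eq_bigr => i _.
by rewrite linearP scalerDl scalerA.
Qed.

Lemma in_VZ c (x : T) : in_V x -> in_V (c *: x).
Proof. by move=> Vx; rewrite -[c *: x]addr0; apply: in_VP => //; apply: in_V0. Qed.

Lemma in_VD (x y : T) : in_V x -> in_V y -> in_V (x + y).
Proof. by move=> Vx Vy; rewrite -[x]scale1r; apply: in_VP. Qed.

Lemma in_V_letter i : in_V (letter i).
Proof. by exists (vbasis {:V})`_i; apply: letterE. Qed.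

(** The vectors [f p] are the rows of the matrix of [s] in the basis of letters. *)
Lemma letter_expansion (s : tens V 2) : tensor_power (@in_V k V) s ->
  exists f : 'I_n -> T, (forall p, in_V (f p)) /\
    s = \sum_p leg 0 (letter p) * leg 1 (f p).
Proof.
elim/tensor_power2_ind => [|t u [f [Vf ->]] [g [Vg ->]]|a b [v ->] Vb].
- exists (fun=> 0); split=> [_|]; first exact: in_V0.
  by rewrite big1 // => p _; rewrite linear0 mulr0.
- exists (fun p => f p + g p); split=> [p|]; first exact: in_VD.
  rewrite -big_split; apply: eq_bigr => p _.
  apply: etrans; first exact: esym (mulrDr _ _ _).
  by apply: f_equal; apply: esym; apply: linearD.
exists (fun p => coord (vbasis {:V}) p v *: b); split=> [p|]; first exact: in_VZ.
rewrite inclE linear_sum mulr_suml; apply: eq_bigr => p _.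
exact: leg_scale_comm.
Qed.

Section Expansion.
Variables (s : tens V 2) (f : 'I_n -> T).
Hypotheses (Vf : forall p, in_V (f p))
  (sE : s = \sum_p leg 0 (letter p) * leg 1 (f p)).

Lemma leg2_expansion m (i j : 'I_m) : i != j ->
  leg2 i j s = \sum_p leg i (letter p) * leg j (f p).
Proof.
by move=> nij; rewrite sE linear_sum; apply: eq_bigr => p _; apply: leg2_pair.
Qed.

Lemma brk_leg2_expansion (i j l : 'I_3) : i != j -> i != l -> j != l ->
  brk (leg2 i j s) (leg2 i l s) =
  \sum_p \sum_q leg i (brk (letter p) (letter q)) * leg j (f p) * leg l (f q).
Proof.
move=> nij nil njl.
apply: etrans; first exact: (f_equal2 _ (leg2_expansion nij) (leg2_expansion nil)).
apply: etrans; first exact: brk_suml.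
apply: eq_bigr => p _; apply: etrans; first exact: brk_sumr.
by apply: eq_bigr => q _; apply: brk_leg2_pairs.
Qed.

Lemma mcoeff_brk_letter (a b p q : 'I_n) :
  (brk (letter a) (letter b))@_(@word k V [:: p; q]) =
  ((a == p) && (b == q))%:R - ((b == p) && (a == q))%:R.
Proof.
have letM (c d : 'I_n) : (letter c * letter d)@_(@word k V [:: p; q])
    = ((c == p) && (d == q))%:R.
  rewrite monoM mcoeff_mono; congr (nat_of_bool _)%:R.
  apply/eqP/andP => [e|[/eqP -> /eqP ->]]; last by apply/ffunP => i; rewrite !ffunE.
  by have := congr1 (fun g : mword n 1 => g ord0) e; rewrite !ffunE => -[-> ->].
apply: etrans; first exact: mcoeffB.
by apply: f_equal2; last apply: f_equal; apply: letM.
Qed.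

Let f_word2 p (u v : 'I_n) : (f p)@_(@word k V [:: u; v]) = 0.
Proof. exact: in_V_mcoeff. Qed.

(** Of the three cyclic summands of [phi_s], only the one whose commutator lies in leg 0 has words
    of length two there; the other two have a vector of V in that leg. *)
Lemma mcoeff_phi (p q r u : 'I_n) :
  (phi_s s)@_(@word3 k V [:: p; q] [:: r] [:: u]) =
  - ((f p)@_(@word k V [:: r]) * (f q)@_(@word k V [:: u])
     - (f q)@_(@word k V [:: r]) * (f p)@_(@word k V [:: u])).
Proof.
set W := word3 _ _ _.
have W0 : W 0 = [:: p; q] by rewrite ffunE.
have W1 : W 1 = [:: r] by rewrite ffunE.
have W2 : W 2 = [:: u] by rewrite ffunE.
pose F a b := (f a)@_(@word k V [:: r]) * (f b)@_(@word k V [:: u]).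
have c0 : (brk (leg2 0 1 s) (leg2 0 2 s))@_W = F p q - F q p.
  rewrite brk_leg2_expansion // raddf_sum.
  (* Both values of [F] become double sums over the same pairs, matching the two terms of the
     coefficient of a commutator of letters. *)
  rewrite -(double_delta F p q) -(double_delta (fun a b => F b a) p q) [in X in _ - X]exchange_big.
  rewrite -sumrB; apply: eq_bigr => a _; rewrite raddf_sum -sumrB.
  apply: eq_bigr => b _ /=; rewrite mcoeff_legs3 W0 W1 W2 mcoeff_brk_letter.
  by rewrite -mulrA mulrBl.
have c1 : (brk (leg2 1 2 s) (leg2 1 0 s))@_W = 0.
  rewrite brk_leg2_expansion // raddf_sum big1 // => a _; rewrite raddf_sum big1 // => b _ /=.
  have -> : leg 1 (brk (letter a) (letter b)) * leg 2 (f a) * leg 0 (f b) =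
      leg 0 (f b) * leg 1 (brk (letter a) (letter b)) * leg 2 (f a) :> tens V 3.
    by apply: esym; apply: mulr_rotl; apply: leg_comm.
  by rewrite mcoeff_legs3 W0 f_word2 !mul0r.
have c2 : (brk (leg2 2 0 s) (leg2 2 1 s))@_W = 0.
  rewrite brk_leg2_expansion // raddf_sum big1 // => a _; rewrite raddf_sum big1 // => b _ /=.
  have -> : leg 2 (brk (letter a) (letter b)) * leg 0 (f a) * leg 1 (f b) =
      leg 0 (f a) * leg 1 (f b) * leg 2 (brk (letter a) (letter b)) :> tens V 3.
    by apply: mulr_rotl; apply: leg_comm.
  by rewrite mcoeff_legs3 W0 f_word2 !mul0r.
rewrite phi_sE; exact: (additive_singleN (f := mcoeff W) c0 c1 c2).
Qed.

Lemma rank_one :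
  (forall p q r u : 'I_n,
     (f p)@_(@word k V [:: r]) * (f q)@_(@word k V [:: u])
     = (f q)@_(@word k V [:: r]) * (f p)@_(@word k V [:: u])) ->
  exists v w : V, s = leg 0 (incl v) * leg 1 (incl w).
Proof.
move=> minors; pose F p q := (f p)@_(@word k V [:: q]).
have [/existsP[p0 /existsP[q0 F0]]|/existsPn F0] :=
    boolP [exists p0, exists q0, F p0 q0 != 0]; last first.
  exists 0, 0; rewrite sE big1 => [|p _].
    have -> : incl (0 : V) = 0.
      by rewrite inclE big1 // => i _; rewrite linear0 scale0r.
    by rewrite linear0 mul0r.
  have -> : f p = 0.
    rewrite (in_V_expand (Vf p)) big1 // => q _.
    have /existsPn/(_ q) := F0 p; rewrite negbK => /eqP Fpq.
    by rewrite -/(F p q) Fpq scale0r.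
  by rewrite linear0 mulr0.
have [w fw] := Vf p0.
(* By the vanishing minors every row is a multiple of the pivot row [p0], with the ratio read in the
   pivot column [q0]. *)
exists (\sum_p (F p q0 / F p0 q0) *: (vbasis {:V})`_p), w.
rewrite -incl_coefs -fw sE linear_sum mulr_suml; apply: eq_bigr => p _.
have -> : f p = (F p q0 / F p0 q0) *: f p0.
  rewrite [LHS](in_V_expand (Vf p)) [in RHS](in_V_expand (Vf p0)) scaler_sumr.
  apply: eq_bigr => q _; rewrite scalerA; congr (_ *: _).
  by rewrite mulrAC [F p q0 * _]minors mulrC mulrA mulVf // mul1r.
exact: esym (leg_scale_comm _ _ _ _ _).
Qed.

End Expansion.

(** Each of the three brackets contains [[v, v]] in its shared leg. *)
Lemma phi_rank_one (v w : V) : phi_s (leg 0 (incl v) * leg 1 (incl w)) = 0.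
Proof.
set s := _ * _; rewrite phi_sE.
have z (i j l : 'I_3) : i != j -> i != l -> j != l -> brk (leg2 i j s) (leg2 i l s) = 0.
  move=> nij nil njl.
  apply: etrans; first exact: (f_equal2 _ (leg2_pair _ _ nij) (leg2_pair _ _ nil)).
  apply: etrans; first exact: brk_leg2_pairs.
  by rewrite brkxx linear0 /= !mul0r.
by apply: opp_sum3_eq0; apply: z.
Qed.

End Rank.

(** * From the explicit cobracket to every representative of the cocycle *)

Section Delta.
Variables (k : fieldType) (V : vectType k) (s : tens V 2).
Hypothesis sV : tensor_power (@in_V k V) s.
Local Notation T := (tens V 1).
Local Notation L := (@free_lie k V).

Lemma cobr_is_delta : is_delta s (cobr s).
Proof.
split; last by move=> v; apply: cobr_incl.
split=> [x Lx|x y Lx Ly]; first exact: cobr_exterior.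
exact: cobr_brk.
Qed.

Lemma is_delta_unique (d : {linear T -> tens V 2}) :
  is_delta s d -> forall x, L x -> d x = cobr s x.
Proof.
move=> [[_ dB] dV]; apply: free_lie_eq => [v|x y Lx Ly dx dy].
  by apply: etrans (dV v) _; apply: esym; apply: cobr_incl.
apply: etrans (dB x y Lx Ly) _; rewrite dx dy; exact: esym (cobr_brk s Lx Ly).
Qed.

Lemma is_delta_defect (d : {linear T -> tens V 2}) : is_delta s d ->
  forall x, L x -> cp (tens_id (p := 1) d (d x)) = brk (diag 3 x) (phi_s s).
Proof.
move=> ds x Lx; apply: etrans (defect_free_lie sV Lx).
apply: f_equal; rewrite (is_delta_unique ds Lx).
apply: (@tens_id_restrict k V 1 L d (cobr s)); first exact: is_delta_unique.
by have [] := cobr_exterior sV Lx.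
Qed.

Lemma is_delta_qlb (d : {linear T -> tens V 2}) : [pchar k] =i pred0 ->
  is_delta s d -> quasi_lie_bialgebra L d (phi_s s).
Proof.
move=> char0 ds; split.
- exact: free_lie_is_lie.
- by case: ds.
- by split; [apply: phi_s_tensor_power | apply: phi_s_antisymmetric].
- exact: is_delta_defect.
apply: etrans (Alt_cobr_phi sV char0); apply: f_equal.
apply: (@tens_id_restrict k V 2 L d (cobr s)); first exact: is_delta_unique.
exact: phi_s_tensor_power.
Qed.

Lemma co_jacobi_iff (d : {linear T -> tens V 2}) : is_delta s d ->
  co_jacobi L d <-> exists v w : V, s = leg 0 (incl v) * leg 1 (incl w).
Proof.
move=> ds; split=> [coJ|[v [w sE]] x Lx]; last first.
  apply: etrans (is_delta_defect ds Lx) _.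
  have phi0 : phi_s s = 0 by rewrite sE; apply: phi_rank_one.
  by rewrite phi0 brk0r.
have [f [Vf sE]] := letter_expansion sV.
apply: (rank_one Vf sE) => p q r u.
(* A minor with a repeated row vanishes trivially; for distinct rows it is, up to sign, a
   coefficient of [phi_s]. *)
case: (eqVneq p q) => [-> //|neq_pq]; apply/eqP; rewrite -subr_eq0 -oppr_eq0.
rewrite -(mcoeff_phi Vf sE); apply/eqP; apply: brk_diag_mcoeff => //.
  exact: phi_s_tensor_power.
have Lp : L (letter p) by apply: in_V_free_lie; apply: in_V_letter.
by apply: etrans (coJ _ Lp); apply: esym; apply: is_delta_defect.
Qed.

End Delta.

(** The first conjunct says that the cocycle exists and is determined on L(V), so the second, which
    ranges over its representatives, is not vacuous. *)
Theorem theorem2p3 (k : fieldType) (V : vectType k) (s : tens V 2)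
    (char0 : [pchar k] =i pred0) (sV : tensor_power (@in_V k V) s) :
  (exists d : {linear tens V 1 -> tens V 2},
     is_delta s d /\
     (forall d' : {linear tens V 1 -> tens V 2}, is_delta s d' ->
        forall x, free_lie x -> d' x = d x)) /\
  (forall d : {linear tens V 1 -> tens V 2}, is_delta s d ->
     quasi_lie_bialgebra (@free_lie k V) d (phi_s s) /\
     (co_jacobi (@free_lie k V) d <->
        exists v w : V, s = leg 0 (incl v) * leg 1 (incl w))).
Proof.
split.
  exists (cobr s : {linear tens V 1 -> tens V 2}); split; first exact: cobr_is_delta.
  by move=> d' ds; apply: is_delta_unique.
move=> d ds; split; first exact: is_delta_qlb.
exact: co_jacobi_iff.
Qed.
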